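(* Let $K$ be an algebraically closed field, let $2\le m\le n$ be integers, and let $\Delta=\Delta_{LT(J)}$ be the Stanley-Reisner complex of the leading term ideal $LT(J)$ of the ideal $J$ of the principal component $Y$ of the first-order jet scheme over the variety of $m\times n$ matrices of rank at most $1$. Then the simplicial complex $\Delta$ is shellable.
   Context: Let $R=K[x_{i,j},y_{i,j} : 1\le i\le m,\ 1\le j\le n]$, let $X(t)=(x_{i,j}+y_{i,j}t)_{i,j}$ be the generic $m\times n$ matrix over $K[t]/(t^2)$, and let $I\subseteq R$ be the ideal generated by the coefficients of the powers of $t$ in all $2\times 2$ minors of $X(t)$. Let $Y$ be the Zariski closure in $\mathbf{A}_K^{2mn}$ of the set of $(A,B)$ in the zero set of $I$ with $\operatorname{rank} A=1$ ($A$ giving the $x$-coordinates, $B$ the $y$-coordinates), and let $J\subseteq R$ be the ideal of all polynomials vanishing on $Y$. $LT(J)$ is the ideal of leading terms of $J$ for the graded reverse lexicographical order with $y_{1,1}>y_{1,2}>\dots>y_{1,n}>y_{2,1}>\dots>y_{m,n}>x_{1,1}>x_{1,2}>\dots>x_{1,n}>x_{2,1}>\dots>x_{m,n}$. It is known that $LT(J)$ is generated by the following squarefree monomials: $A=\{x_{i,l}x_{j,k} : 1\le i<j\le m,\ 1\le k<l\le n\}$, $B=\{x_{i,k}y_{j,l} : 1\le i<j\le m,\ 1\le k<l\le n\}$, $C=\{x_{k,p}y_{j,q}y_{i,r} : 1\le i<j\le k\le m,\ 1\le p<q<r\le n\}$, $D=\{x_{i,r}y_{j,q}y_{k,p} :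 1\le i<j<k\le m,\ 1\le p<q\le r\le n\}$, $E=\{y_{i,r}y_{j,q}y_{k,p} : 1\le i<j<k\le m,\ 1\le p<q<r\le n\}$. The Stanley-Reisner complex $\Delta_{LT(J)}$ is the simplicial complex on the vertex set $\{x_{i,j},y_{i,j} : 1\le i\le m,\ 1\le j\le n\}$ whose faces are the subsets whose product, as a monomial, does not belong to $LT(J)$. A simplicial complex is pure if all its facets (maximal faces) have the same dimension. A simplicial complex is shellable if it is pure and its facets can be given a total order $F_1,\dots,F_e$ such that for all $1\le j<i\le e$ there exist $v\in F_i\setminus F_j$ and an index $k$, $1\le k<i$, with $F_i\setminus F_k=\{v\}$. *)

(* Defs.v *)
From mathcomp Require Import all_boot all_order all_algebra.
From mathcomp Require Export mpoly.

Set Implicit Arguments.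
Unset Strict Implicit.
Unset Printing Implicit Defensive.

Import Order.TTheory GRing.Theory.
Local Open Scope ring_scope.

Record simplicial_complex (V : finType) := SimplicialComplex {
  face :> {set V} -> Prop;
  face_subset : forall F G : {set V}, G \subset F -> face F -> face G
}.

Section Complexes.
Variables (V : finType) (D : simplicial_complex V).

Definition facet (F : {set V}) : Prop :=
  D F /\ forall G : {set V}, D G -> F \subset G -> G = F.

Definition pure : Prop :=
  forall F G : {set V}, facet F -> facet G -> #|F| = #|G|.

Definition shelling (s : seq {set V}) : Prop :=
  [/\ uniq s, (forall F : {set V}, F \in s <-> facet F) &
      forall i j : nat, (j < i < size s)%N ->
        exists v k, [/\ v \in nth set0 s i :\: nth set0 s j, (k < i)%N &
                        nth set0 s i :\: nth set0 s k = [set v]]].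

Definition shellable : Prop := pure /\ exists s : seq {set V}, shelling s.

End Complexes.

Section Ideals.
Variables (K : fieldType) (N : nat).
Implicit Types (S : {mpoly K[N]} -> Prop) (Z : 'rV[K]_N -> Prop).

Definition ideal_gen S (p : {mpoly K[N]}) : Prop :=
  exists s : seq ({mpoly K[N]} * {mpoly K[N]}),
    (forall c, c \in s -> S c.2) /\ p = \sum_(c <- s) c.1 * c.2.

Lemma ideal_gen_mull S p q : ideal_gen S p -> ideal_gen S (q * p).
Proof.
case=> s [sS ->]; exists [seq (q * c.1, c.2) | c <- s]; split.
  by move=> _ /mapP[c cs ->]; exact: (sS _ cs).
by rewrite big_map big_distrr /=; apply: eq_bigr => c _; rewrite mulrA.
Qed.

(* Affine N-space is 'rV[K]_N. *)
Definition zeros S (z : 'rV[K]_N) : Prop :=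
  forall p : {mpoly K[N]}, S p -> p.@[z 0] = 0.

Definition zariski_closed Z : Prop :=
  exists S, forall z, Z z <-> zeros S z.

Definition zariski_closure Z (z : 'rV[K]_N) : Prop :=
  forall Z', zariski_closed Z' -> (forall w, Z w -> Z' w) -> Z' z.

Definition vanishing_ideal Z (p : {mpoly K[N]}) : Prop :=
  forall z, Z z -> p.@[z 0] = 0.

(* Graded reverse lexicographic order for 'X_0 > 'X_1 > ... > 'X_(N-1). *)
Definition grevlex_lt (a b : 'X_{1..N}) : Prop :=
  (mdeg a < mdeg b)%N \/
  (mdeg a = mdeg b /\
   exists i : 'I_N, (b i < a i)%N /\ forall j : 'I_N, (i < j)%N -> a j = b j).

Definition leading_monomial (p : {mpoly K[N]}) (a : 'X_{1..N}) : Prop :=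
  a \in msupp p /\ forall b, b \in msupp p -> b = a \/ grevlex_lt b a.

Definition leading_term (p t : {mpoly K[N]}) : Prop :=
  exists a : 'X_{1..N}, leading_monomial p a /\ t = p@_a *: 'X_[a].

Definition leading_ideal S : {mpoly K[N]} -> Prop :=
  ideal_gen (fun t => exists p : {mpoly K[N]}, S p /\ leading_term p t).

Section StanleyReisner.
Variable S : {mpoly K[N]} -> Prop.

Definition stanley_reisner_face (F : {set 'I_N}) : Prop :=
  ~ ideal_gen S (\prod_(v in F) 'X_v).

Lemma stanley_reisner_face_subset (F G : {set 'I_N}) :
  G \subset F -> stanley_reisner_face F -> stanley_reisner_face G.
Proof.
move=> sGF nF hG; apply: nF.
rewrite (big_setID G) /= (setIidPr sGF) mulrC.
exact: ideal_gen_mull.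
Qed.

(* For the ideal generated by S, with vertex v standing for 'X_v. *)
Definition stanley_reisner : simplicial_complex 'I_N :=
  SimplicialComplex stanley_reisner_face_subset.

End StanleyReisner.
End Ideals.

Lemma index_allpairs (S T : eqType) (s : seq S) (t : seq T) x y : x \in s -> y \in t ->
  index (x,y) [seq (a,b) | a <- s, b <- t] = (index x s * size t + index y t)%N.
Proof.
move=> xs yt; elim: s xs => //= a s IH; rewrite index_cat inE.
case: (eqVneq x a) => [->|nxa] /= xs.
  have ax: injective (pair a : T -> S * T) by move=> ? ? [].
  by rewrite mem_map // yt index_map // eqxx.
rewrite ifF ?size_map; last by apply/negP=> /mapP[b _ [E _]]; rewrite E eqxx in nxa.
by rewrite IH // mulSn addnA.
Qed.

(* mxvec_index is row-major, so the order of the y_(i,j), and likewise that of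
   the x_(i,j), follows the order of their indices. *)
Lemma val_mxvec_index m n (i : 'I_m) (j : 'I_n) :
  mxvec_index i j = (i * n + j)%N :> nat.
Proof.
rewrite /mxvec_index /=.
set e := enum {: 'I_m * 'I_n}; set r := enum_rank (i, j).
have er: nth (i, j) e r = (i, j) := nth_enum_rank (i, j) (i, j).
have re: (r < size e)%N by rewrite -cardE.
rewrite -(index_uniq (i, j) re (enum_uniq _)) er /e enumT unlock /= /prod_enum.
by rewrite index_allpairs ?mem_enum // !index_enum_ord size_enum_ord.
Qed.

Section JetScheme.
Variables (K : fieldType) (m n : nat).

(* The 2mn variables are numbered so that all the y_(i,j) come first (and are
   thus the largest for grevlex_lt), followed by all the x_(i,j). *)
Local Notation N := (m * n + m * n)%N.
Local Notation R := {mpoly K[N]}.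

Definition xvar (i : 'I_m) (j : 'I_n) : R := 'X_(rshift (m * n) (mxvec_index i j)).
Definition yvar (i : 'I_m) (j : 'I_n) : R := 'X_(lshift (m * n) (mxvec_index i j)).

(* The t-variable is 'X; only the coefficients of t^0 and t^1 matter below, since
   t^2 = 0. *)
Definition generic_jet_matrix : 'M[{poly R}]_(m, n) :=
  \matrix_(i, j) ((xvar i j)%:P + (yvar i j)%:P * 'X).

Definition jet_minor_coef (p : R) : Prop :=
  exists (f : 'I_2 -> 'I_m) (g : 'I_2 -> 'I_n) (c : nat),
    [/\ {homo f : a b / (a < b)%N}, {homo g : a b / (a < b)%N}, (c < 2)%N &
        p = (\det (mxsub f g generic_jet_matrix))`_c].

Definition jet_ideal : R -> Prop := ideal_gen jet_minor_coef.

(* The pair (A, B) as a point of affine 2mn-space. *)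
Definition jet_point (A B : 'M[K]_(m, n)) : 'rV[K]_N := row_mx (mxvec B) (mxvec A).

Definition principal_component : 'rV[K]_N -> Prop :=
  zariski_closure (fun z => exists A B : 'M[K]_(m, n),
    [/\ z = jet_point A B, zeros jet_ideal z & \rank A = 1%N]).

Definition principal_ideal : R -> Prop := vanishing_ideal principal_component.

Definition jet_complex : simplicial_complex 'I_N :=
  stanley_reisner (leading_ideal principal_ideal).

End JetScheme.

(* Main.v *)
(* Write x = A and y = B for the coordinates.  The principal component is
   parametrized by A = u v^T, B = u w^T + z v^T, so J is the kernel of the
   corresponding ring map.

   The generators of type A, B, C, D, E of LT(J) are leading terms of explicit
   2-minors and 3-minors (and polarizations of these) that vanish on all (A, B)
   of this form, so every face of the complex avoids them.  A maximal set of
   vertices avoiding them consists of three lattice paths: a chain of x-cells from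
   some cell (a, b) to the bottom right corner, and two disjoint paths of y-cells,
   an upper one ending in row a in the last column, and a lower one ending in
   column b in the last row.

   Conversely, such a triple of paths is a face.  Expand the image of a monomial
   under the parametrization by choosing u_i w_j or z_i v_j for each factor y_ij.
   For a monomial supported on the triple, choose u_i w_j on the upper path and
   z_i v_j on the lower one.  The cells of the triple then form a spanning tree on
   the u_i, v_j, w_j, z_i (z_1 excepted), and processing the cells from the last
   one to the first (the greedy algorithm of transportation problems) shows that
   the resulting monomial in u, v, w, z does not occur in the image of any smaller
   monomial, and occurs exactly once in the image of the given one.  Hence no
   element of J has a leading monomial supported on the triple.

   All triples have the same cardinality.  A shelling is obtained by sorting them
   first by the position of (a, b) and then by the area below the paths: a facet
   can be moved to an earlier one by removing its first x-cell, or by flipping a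
   corner of one of its paths. *)
Require Import Defs.
From mathcomp Require Import all_boot all_order all_algebra.
From mathcomp Require Import zify ring.
From Stdlib Require Import Classical.

Set Implicit Arguments.
Unset Strict Implicit.
Unset Printing Implicit Defensive.

Import Order.TTheory GRing.Theory.

(** * Shellings from a key *)

Lemma ex_minimal (P : nat -> Prop) :
  (exists k, P k) -> exists k, P k /\ forall l, P l -> k <= l.
Proof.
case=> k; elim/ltn_ind: k => k IH Pk.
have [[l [Pl ltlk]]|nl] := classic (exists l, P l /\ l < k); first exact: IH Pl.
by exists k; split=> // l Pl; rewrite leqNgt; apply/negP => ltlk; apply: nl; exists l.
Qed.

(** A facet may have several indices, so facets are sorted by the least key among their indices.
    Applied to an index of least key, the exchange yields a facet of strictly smaller key, hence an
    earlier one; ties can be ordered arbitrarily. *)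
Lemma shellable_by_key (V : finType) (D : simplicial_complex V) (I : Type)
    (P : I -> Prop) (T : I -> {set V}) (key : I -> nat) :
  (forall F, facet D F <-> exists d, P d /\ T d = F) -> pure D ->
  (forall c d, P c -> P d -> T c <> T d -> key c <= key d ->
     exists v d', [/\ P d', key d' < key d, v \in T d :\: T c &
                      T d :\: T d' = [set v]]) ->
  shellable D.
Proof.
move=> facetE pureD exch; split=> //.
have [b bP]: exists b : {set V} -> bool, forall F, b F <-> facet D F.
  apply: (@fin_all_exists {set V} (fun=> bool) (fun F b => b <-> facet D F)) => F.
  have [fF|nF] := classic (facet D F); [by exists true | by exists false].
pose isk F k := facet D F -> (exists d, [/\ P d, T d = F & key d = k]) /\
  forall d, P d -> T d = F -> k <= key d.
have [K KP]: exists K : {set V} -> nat, forall F, isk F (K F).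
  apply: (@fin_all_exists {set V} (fun=> nat) isk) => F.
  have [fF|nF] := classic (facet D F); last by exists 0.
  have [|k [kP mink]] := @ex_minimal (fun k => exists d, [/\ P d, T d = F & key d = k]).
    by have /facetE[d [Pd TdF]] := fF; exists (key d), d.
  by exists k => _; split=> // d Pd TdF; apply: mink; exists d.
pose le := relpre K leq; pose s := sort le (filter b (enum {set V})).
have le_tot : total le by move=> x y; apply: leq_total.
have memS F : F \in s <-> facet D F.
  by rewrite mem_sort mem_filter mem_enum inE andbT; apply: bP.
have uniqS : uniq s by rewrite sort_uniq filter_uniq // enum_uniq.
have le_nth i j : j <= i -> i < size s -> K (nth set0 s j) <= K (nth set0 s i).
  move=> leji ltis; have le_tr : transitive le by move=> y x z; apply: leq_trans.
  have := @sorted_leq_nth _ le le_tr (fun x => leqnn (K x)) set0 s (sort_sorted le_tot _) j i.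
  by apply=> //; rewrite inE; lia.
exists s; split=> // i j /andP[ltji ltis].
have ltjs := ltn_trans ltji ltis.
have /KP[[d [Pd Td Kd]] _] : facet D (nth set0 s i) by apply/memS/mem_nth.
have /KP[[c [Pc Tc Kc]] _] : facet D (nth set0 s j) by apply/memS/mem_nth.
have neq : T c <> T d by rewrite Tc Td => /eqP; rewrite nth_uniq //; lia.
have lek : key c <= key d by rewrite Kd Kc; apply: le_nth => //; lia.
have [v [d' [Pd' ltk vP dv]]] := exch c d Pc Pd neq lek.
have fH : facet D (T d') by apply/facetE; exists d'.
have Hs : T d' \in s by apply/memS.
exists v, (index (T d') s); rewrite -Td -Tc nth_index //; split=> //.
rewrite ltnNge; apply/negP => leik.
have := le_nth _ _ leik; rewrite index_mem nth_index // => /(_ Hs).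
by have [_ /(_ d' Pd' erefl)] := KP _ fH; lia.
Qed.

(** * Triples of lattice paths *)

Section Cells.
Variables m n : nat.
Local Notation N := (m * n + m * n).

Definition yi (i : 'I_m) (j : 'I_n) : 'I_N := lshift (m * n) (mxvec_index i j).
Definition xi (i : 'I_m) (j : 'I_n) : 'I_N := rshift (m * n) (mxvec_index i j).

(** Division by [n] inverts the row-major [mxvec_index]. Predicates on natural numbers keep ordinals
    out of the arithmetic of paths. *)
Definition cell_set (py px : nat -> nat -> bool) : {set 'I_N} :=
  [set v | match split v with
           | inl k => py (k %/ n) (k %% n)
           | inr k => px (k %/ n) (k %% n)
           end].

Lemma mem_cell_y py px i j : (yi i j \in cell_set py px) = py i j.
Proof.
have n0 : 0 < n by case: j => /= j; lia.
rewrite inE /yi; case: splitP => k Ek.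
  have E : i * n + j = k by rewrite -val_mxvec_index; exact: Ek.
  by rewrite -E divnMDl // modnMDl divn_small // modn_small // addn0.
have E : mxvec_index i j = m * n + k :> nat := Ek.
by have := ltn_ord (mxvec_index i j); lia.
Qed.

Lemma mem_cell_x py px i j : (xi i j \in cell_set py px) = px i j.
Proof.
have n0 : 0 < n by case: j => /= j; lia.
rewrite inE /xi; case: splitP => k Ek; last first.
  have E : m * n + mxvec_index i j = m * n + k :> nat := Ek.
  have {}E : i * n + j = k by rewrite -val_mxvec_index; lia.
  by rewrite -E divnMDl // modnMDl divn_small // modn_small // addn0.
have E : m * n + mxvec_index i j = k :> nat := Ek.
by have := ltn_ord k; lia.
Qed.

Lemma cellP (v : 'I_N) : (exists i j, v = yi i j) \/ (exists i j, v = xi i j).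
Proof.
by case: (split_ordP v) => k ->; case/mxvec_indexP: k => i j; [left|right]; exists i, j.
Qed.

Lemma val_yi i j : yi i j = i * n + j :> nat.
Proof. exact: val_mxvec_index. Qed.

Lemma val_xi i j : xi i j = m * n + (i * n + j) :> nat.
Proof. by rewrite -val_mxvec_index. Qed.

Lemma eq_pos (i i' : 'I_m) (j j' : 'I_n) :
  (i * n + j == i' * n + j') = (i == i') && (j == j').
Proof.
have n0 : 0 < n by case: j => /= j; lia.
apply/eqP/andP => [E|[/eqP-> /eqP->]//].
have: (i * n + j) %/ n = (i' * n + j') %/ n by rewrite E.
have: (i * n + j) %% n = (i' * n + j') %% n by rewrite E.
rewrite !divnMDl // !modnMDl !divn_small // !modn_small // !addn0 => ? ?.
by split; apply/eqP/val_inj.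
Qed.

Lemma eq_yi i j i' j' : (yi i j == yi i' j') = (i == i') && (j == j').
Proof. by rewrite -(inj_eq (@ord_inj _)) !val_yi eq_pos. Qed.

Lemma eq_xi i j i' j' : (xi i j == xi i' j') = (i == i') && (j == j').
Proof. by rewrite -(inj_eq (@ord_inj _)) !val_xi eqn_add2l eq_pos. Qed.

Lemma eq_xi_yi i j i' j' : (xi i j == yi i' j') = false.
Proof.
have lt : yi i' j' < m * n := ltn_ord (mxvec_index i' j').
apply/negP=> /eqP E; rewrite -E val_xi in lt; lia.
Qed.

Lemma lt_yi_row (i i' : 'I_m) (j j' : 'I_n) : (i < i') -> (yi i j < yi i' j').
Proof. by move=> lt; rewrite !val_yi; have := ltn_ord j; have := ltn_ord j'; nia. Qed.

Lemma lt_yi_col (i : 'I_m) (j j' : 'I_n) : (j < j') -> (yi i j < yi i j').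
Proof. by move=> lt; rewrite !val_yi ltn_add2l. Qed.

Lemma lt_xi_row (i i' : 'I_m) (j j' : 'I_n) : (i < i') -> (xi i j < xi i' j').
Proof. by move=> lt; rewrite !val_xi ltn_add2l -!val_yi lt_yi_row. Qed.

Lemma lt_xi_col (i : 'I_m) (j j' : 'I_n) : (j < j') -> (xi i j < xi i j').
Proof. by move=> lt; rewrite !val_xi !ltn_add2l. Qed.

Lemma lt_yi_xi (i i' : 'I_m) (j j' : 'I_n) : (yi i j < xi i' j').
Proof. by rewrite val_xi; apply: ltn_addr; apply: (ltn_ord (mxvec_index i j)). Qed.

Lemma cell_setD_y (py px py' px' : nat -> nat -> bool) (i0 : 'I_m) (j0 : 'I_n) :
  (forall i j, i < m -> j < n -> (py i j && ~~ py' i j) = (i == i0) && (j == j0)) ->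
  (forall i j, i < m -> j < n -> px i j -> px' i j) ->
  cell_set py px :\: cell_set py' px' = [set yi i0 j0].
Proof.
move=> Hy Hx; apply/setP=> v; rewrite in_setD in_set1.
case: (cellP v) => [][i [j ->]].
  by rewrite !mem_cell_y eq_yi andbC Hy.
rewrite !mem_cell_x eq_xi_yi; apply/negP=> /andP[/negP nx' xij].
exact/nx'/Hx.
Qed.

Lemma cell_setD_x (py px py' px' : nat -> nat -> bool) (i0 : 'I_m) (j0 : 'I_n) :
  (forall i j, i < m -> j < n -> (px i j && ~~ px' i j) = (i == i0) && (j == j0)) ->
  (forall i j, i < m -> j < n -> py i j -> py' i j) ->
  cell_set py px :\: cell_set py' px' = [set xi i0 j0].
Proof.
move=> Hx Hy; apply/setP=> v; rewrite in_setD in_set1.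
case: (cellP v) => [][i [j ->]]; last first.
  by rewrite !mem_cell_x eq_xi andbC Hx.
rewrite !mem_cell_y eq_sym eq_xi_yi; apply/negP=> /andP[/negP ny' yij].
exact/ny'/Hy.
Qed.

End Cells.

Definition in_path (r0 r1 : nat) (h : nat -> nat) (i j : nat) : bool :=
  [&& r0 <= i, i <= r1, h i <= j & j <= h i.+1].

(* [(pa, pb)] is the first cell of the path of x-cells, which occupies the rows
   from [pa] on.  The upper path of y-cells occupies the rows from [0] to [pa], the
   lower one the rows from [1] on.  In row [i], these paths consist of the columns
   from [h i] to [h i.+1], where [h] is [pg], [pe] and [pf], respectively. *)
Record path_data := PathData {
  pa : nat; pb : nat; pe : nat -> nat; pf : nat -> nat; pg : nat -> nat
}.

Section Paths.
Variables m n : nat.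

(** [pf_lt_pe] is disjointness of the two paths of y-cells: in each common row the lower one ends
    strictly to the left of the upper one. Values outside the stated ranges are free, so different
    [d] may give the same facet. *)
Record valid (d : path_data) : Prop := Valid {
  lt_pa : pa d < m;
  lt_pb : pb d < n;
  pe_start : pe d 0 = 0;
  pe_end : pe d (pa d).+1 = n.-1;
  pe_mono : forall i, i <= pa d -> pe d i <= pe d i.+1;
  pf_start : pf d 1 = 0;
  pf_end : pf d m = pb d;
  pf_mono : forall i, 0 < i < m -> pf d i <= pf d i.+1;
  pg_start : pg d (pa d) = pb d;
  pg_end : pg d m = n.-1;
  pg_mono : forall i, pa d <= i < m -> pg d i <= pg d i.+1;
  pf_lt_pe : forall i, 0 < i <= pa d -> pf d i.+1 < pe d i
}.

Definition upper d := in_path 0 (pa d) (pe d).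
Definition lower d := in_path 1 m.-1 (pf d).
Definition ycells d i j := upper d i j || lower d i j.
Definition xcells d := in_path (pa d) m.-1 (pg d).
Definition path_set d : {set 'I_(m * n + m * n)} := cell_set m n (ycells d) (xcells d).

Lemma mono_leq (h : nat -> nat) r0 r1 : (forall i, r0 <= i < r1 -> h i <= h i.+1) ->
  forall i j, r0 <= i -> i <= j -> j <= r1 -> h i <= h j.
Proof.
move=> hm i j r0i; elim: j => [|j IH]; first by rewrite leqn0 => /eqP->.
rewrite leq_eqVlt => /orP[/eqP->//|lij ljr].
by apply: leq_trans (IH _ _) (hm _ _); lia.
Qed.

Section Valid.
Variables (d : path_data) (vd : valid d).

Lemma pe_leq i j : i <= j -> j <= (pa d).+1 -> pe d i <= pe d j.
Proof. by apply: (mono_leq (r0 := 0)) => // k kl; apply: pe_mono => //; lia. Qed.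

Lemma pf_leq i j : 0 < i -> i <= j -> j <= m -> pf d i <= pf d j.
Proof. by apply: mono_leq => k kl; apply: pf_mono => //; lia. Qed.

Lemma pg_leq i j : pa d <= i -> i <= j -> j <= m -> pg d i <= pg d j.
Proof. by apply: mono_leq => k kl; apply: pg_mono => //; lia. Qed.

Lemma pe_bound i : i <= (pa d).+1 -> pe d i < n.
Proof.
by move=> ia; have := pe_leq ia (leqnn _); rewrite (pe_end vd); have := lt_pb vd; lia.
Qed.

Lemma pf_bound i : 0 < i -> i <= m -> pf d i <= pb d.
Proof. by move=> i0 im; rewrite -(pf_end vd); apply: pf_leq. Qed.

Lemma pg_bound i : pa d <= i -> i <= m -> pb d <= pg d i < n.
Proof.
move=> i0 im; have := pg_leq (leqnn _) i0 im; have := pg_leq i0 im (leqnn _).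
by rewrite (pg_end vd) (pg_start vd); have := lt_pb vd; lia.
Qed.

(** If [pa d] is m - 1, disjointness in the last row gives pb = pf m < pe (m - 1) <= n - 1. So the
    x-path never starts at the bottom right corner. *)
Lemma start_neq_end : 1 < m -> (pa d).+1 < m \/ (pb d).+1 < n.
Proof.
move=> m1; have [am|am] := ltnP (pa d).+1 m; [by left | right].
have am' : (pa d).+1 = m by have := lt_pa vd; lia.
have /= := @pf_lt_pe d vd (pa d); have := pe_bound (leqnSn (pa d)).
by rewrite am' (pf_end vd); lia.
Qed.

End Valid.
End Paths.

(** * Exchange between triples of paths *)

Definition upd (h : nat -> nat) (k v : nat) : nat -> nat :=
  fun i => if i == k then v else h i.

Ltac eq_cases := repeat (let E := fresh in
  case: eqP => E; [first [case: E => ?; subst | subst] | ]).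

Section Flips.
Variables m n : nat.
Hypothesis m1 : 1 < m.

(** Only the values that [valid] does not prescribe are summed. *)
Definition corner_sum (d : path_data) (i : nat) : nat :=
  (if 0 < i <= pa d then pe d i else 0) + (if 1 < i < m then pf d i else 0) +
  (if pa d < i < m then pg d i else 0).

Definition area (d : path_data) : nat := \sum_(i < m.+1) corner_sum d i.

(* The facets are compared by their number of x-cells, then by the number of rows
   below the first x-cell, then by area. *)
Definition key (d : path_data) : nat :=
  ((m.-1 - pa d + (n.-1 - pb d)) * m + (m.-1 - pa d)) * (m.+1 * (3 * n)) + area d.

(** Hence the first part of [key] takes precedence over the area, as in a lexicographic order. *)
Lemma area_bound d : valid m n d -> area d < m.+1 * (3 * n).
Proof.
move=> vd; have n0 : 0 < n by have := lt_pb vd; lia.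
apply: (@leq_ltn_trans (\sum_(i < m.+1) (3 * n.-1))); last first.
  by rewrite sum_nat_const card_ord ltn_mul2l /=; lia.
apply: leq_sum => i _; rewrite /corner_sum.
have := ltn_ord i; have := lt_pa vd; have := lt_pb vd.
have := @pe_bound _ _ _ vd i; have := @pf_bound _ _ _ vd i; have := @pg_bound _ _ _ vd i.
by move: (nat_of_ord i) => {}i; do ![case: ifP => ?]; lia.
Qed.

Lemma area_lt d d' k : k <= m -> (forall i, i <= m -> corner_sum d' i <= corner_sum d i) ->
  corner_sum d' k < corner_sum d k -> area d' < area d.
Proof.
move=> km le lt; rewrite /area.
have ko : k < m.+1 by [].
rewrite (bigD1 (Ordinal ko)) //= [X in _ < X](bigD1 (Ordinal ko)) //=.
by rewrite -addSn leq_add // leq_sum // => i _; apply: le; rewrite -ltnS.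
Qed.

Lemma area_eq c d : (forall i, i <= m -> corner_sum d i <= corner_sum c i) ->
  area c <= area d -> forall i, i <= m -> corner_sum d i = corner_sum c i.
Proof.
move=> le lea i im; apply/eqP; rewrite eqn_leq le //= leqNgt; apply/negP => lt.
by have := area_lt im le lt; lia.
Qed.

(** Decreasing [pe d k.+1] by one trades the corner (k, pe (k+1)) for (k+1, pe (k+1) - 1). If the
    latter cell is on the lower path, that path is pushed left as well and cedes the cell to the
    upper one, so only one vertex is lost. For k + 2 = m the value [pf d m] is prescribed and no
    push is possible, whence the last hypothesis. *)
Lemma flip_upper d k : valid m n d -> k < pa d -> pe d k < pe d k.+1 -> 1 < pe d k.+1 ->
    (k.+2 < m) || ((pf d k.+2).+1 < pe d k.+1) ->
  exists d', [/\ valid m n d', pa d' = pa d, pb d' = pb d, area d' < area d &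
    exists (i : 'I_m) (j : 'I_n), [/\ i = k :> nat, j = pe d k.+1 :> nat &
      path_set m n d :\: path_set m n d' = [set yi i j]]].
Proof.
move=> vd ka lte lte1 hk.
have am := lt_pa vd; have bn := lt_pb vd.
have kb := @pe_bound _ _ _ vd k.+1 ltac:(lia).
have ltfe := @pf_lt_pe _ _ _ vd.
pose f' := if (pf d k.+2).+1 == pe d k.+1 then upd (pf d) k.+2 (pf d k.+2).-1 else pf d.
pose d' := PathData (pa d) (pb d) (upd (pe d) k.+1 (pe d k.+1).-1) f' (pg d).
have e1 := @pe_mono _ _ _ vd k.+1 ltac:(lia).
have f1 := @pf_mono _ _ _ vd k.+1 ltac:(lia).
have f2 : k.+2 < m -> pf d k.+2 <= pf d k.+3 by move=> ?; apply: (pf_mono vd); lia.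
have fe1 := ltfe k.+1 ltac:(lia).
have fe0 : 0 < k -> pf d k.+1 < pe d k by move=> ?; apply: ltfe; lia.
have f01 := pf_start vd.
have e0 := pe_start vd.
have f00 : k = 0 -> pf d k.+1 = 0 by move=> ->.
exists d'; split=> //.
- split=> //=.
  + by have := pe_end vd; rewrite /upd; case: eqP; lia.
  + move=> i ia; rewrite /upd; have := @pe_mono _ _ _ vd i ia.
    by eq_cases; lia.
  + by rewrite /f'; case: ifP => _; rewrite /upd ?(pf_start vd).
  + by have := pf_end vd; rewrite /f' /upd; eq_cases; lia.
  + move=> i ia; rewrite /f' /upd; have := @pf_mono _ _ _ vd i ia.
    by eq_cases; lia.
  + exact: pg_start vd.
  + exact: pg_end vd.
  + exact: pg_mono vd.
  + move=> i ia; have := ltfe i ia; rewrite /f' /upd.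
    by eq_cases; lia.
- apply: (@area_lt _ _ k.+1); first by lia.
    move=> i im; rewrite /corner_sum /= /f' /upd.
    by eq_cases; do ![case: ifP => ?]; lia.
  rewrite /corner_sum /= /f' /upd eqxx.
  by eq_cases; do ![case: ifP => ?]; lia.
have km : k < m by lia.
exists (Ordinal km), (Ordinal kb); split=> //.
apply: cell_setD_y => //= i j im jn.
rewrite /ycells /upper /lower /in_path /d' /= /f' /upd.
have ei : i <= pa d -> pe d i <= pe d i.+1 by apply: (pe_mono vd).
have fi : 0 < i < m -> pf d i <= pf d i.+1 by apply: (pf_mono vd).
have fei : 0 < i <= pa d -> pf d i.+1 < pe d i by apply: ltfe.
by eq_cases; lia.
Qed.

(** The lower path moves away from the upper one, which can stay in place. *)
Lemma flip_lower d k : valid m n d -> 0 < k -> k.+1 < m -> pf d k < pf d k.+1 ->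
  exists d', [/\ valid m n d', pa d' = pa d, pb d' = pb d, area d' < area d &
    exists (i : 'I_m) (j : 'I_n), [/\ i = k :> nat, j = pf d k.+1 :> nat &
      path_set m n d :\: path_set m n d' = [set yi i j]]].
Proof.
move=> vd k0 km ltf.
have am := lt_pa vd; have bn := lt_pb vd.
have kb : pf d k.+1 < n by have := @pf_bound _ _ _ vd k.+1; lia.
have ltfe := @pf_lt_pe _ _ _ vd.
pose d' := PathData (pa d) (pb d) (pe d) (upd (pf d) k.+1 (pf d k.+1).-1) (pg d).
have f1 := @pf_mono _ _ _ vd k.+1 ltac:(lia).
exists d'; split=> //.
- split=> //=; try by [exact: pe_start vd | exact: pe_end vd | exact: pe_mono vd
    | exact: pg_start vd | exact: pg_end vd | exact: pg_mono vd].
  + by rewrite /upd; case: ifP => [?|_]; [lia | apply: pf_start vd].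
  + by rewrite /upd; case: ifP => [?|_]; [lia | apply: pf_end vd].
  + by move=> i ia; rewrite /upd; have := @pf_mono _ _ _ vd i ia; eq_cases; lia.
  + by move=> i ia; have := ltfe i ia; rewrite /upd; eq_cases; lia.
- apply: (@area_lt _ _ k.+1); first by lia.
    move=> i im; rewrite /corner_sum /= /upd.
    by eq_cases; do ![case: ifP => ?]; lia.
  rewrite /corner_sum /= /upd eqxx.
  by eq_cases; do ![case: ifP => ?]; lia.
exists (Ordinal (ltnW km)), (Ordinal kb); split=> //.
apply: cell_setD_y => //= i j im jn.
rewrite /ycells /upper /lower /in_path /d' /= /upd.
have ei : i <= pa d -> pe d i <= pe d i.+1 by apply: (pe_mono vd).
have fi : 0 < i < m -> pf d i <= pf d i.+1 by apply: (pf_mono vd).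
have fei : 0 < i <= pa d -> pf d i.+1 < pe d i by apply: ltfe.
by eq_cases; lia.
Qed.

Lemma flip_x d k : valid m n d -> pa d <= k -> k.+1 < m -> pg d k < pg d k.+1 ->
  exists d', [/\ valid m n d', pa d' = pa d, pb d' = pb d, area d' < area d &
    exists (i : 'I_m) (j : 'I_n), [/\ i = k :> nat, j = pg d k.+1 :> nat &
      path_set m n d :\: path_set m n d' = [set xi i j]]].
Proof.
move=> vd k0 km ltg.
have am := lt_pa vd; have bn := lt_pb vd.
have kb : pg d k.+1 < n by have := @pg_bound _ _ _ vd k.+1; lia.
pose d' := PathData (pa d) (pb d) (pe d) (pf d) (upd (pg d) k.+1 (pg d k.+1).-1).
have g1 := @pg_mono _ _ _ vd k.+1 ltac:(lia).
exists d'; split=> //.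
- split=> //=; try by [exact: pe_start vd | exact: pe_end vd | exact: pe_mono vd
    | exact: pf_start vd | exact: pf_end vd | exact: pf_mono vd | exact: pf_lt_pe vd].
  + by rewrite /upd; case: ifP => [?|_]; [lia | apply: pg_start vd].
  + by rewrite /upd; case: ifP => [?|_]; [lia | apply: pg_end vd].
  + by move=> i ia; rewrite /upd; have := @pg_mono _ _ _ vd i ia; eq_cases; lia.
- apply: (@area_lt _ _ k.+1); first by lia.
    move=> i im; rewrite /corner_sum /= /upd.
    by eq_cases; do ![case: ifP => ?]; lia.
  rewrite /corner_sum /= /upd eqxx.
  by eq_cases; do ![case: ifP => ?]; lia.
exists (Ordinal (ltnW km)), (Ordinal kb); split=> //.
apply: cell_setD_x => //= i j im jn.
rewrite /xcells /in_path /d' /= /upd.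
have gi : pa d <= i < m -> pg d i <= pg d i.+1 by apply: (pg_mono vd).
by eq_cases; lia.
Qed.

Ltac upd_cases m d i :=
  do ![case: eqP => ?];
  try ((have ? : i = m.-1 by lia); subst i); try ((have ? : i = m.-2 by lia); subst i);
  try ((have ? : i = pa d by lia); subst i); lia.

(* When the lower path, extended to column [b + 1], runs into the upper path
   (which forces [a = m - 1]), the latter is pushed one column to the right. *)
Lemma start_right d : valid m n d -> pb d < pg d (pa d).+1 ->
    ((pa d).+1 < m) || ((pb d).+2 < n) ->
  exists d', [/\ valid m n d', pa d' = pa d, pb d' = (pb d).+1 &
    exists (i : 'I_m) (j : 'I_n), [/\ i = pa d :> nat, j = pb d :> nat &
      path_set m n d :\: path_set m n d' = [set xi i j]]].
Proof.
move=> vd ltb hs.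
have am := lt_pa vd; have bn := lt_pb vd.
have ltfe := @pf_lt_pe _ _ _ vd.
have gb := @pg_bound _ _ _ vd (pa d).+1 ltac:(lia) ltac:(lia).
have g0 := pg_start vd. have f0 := pf_end vd. have e1 := pe_end vd.
have fm : pf d m.-1 <= pf d m.-1.+1 by apply: (pf_mono vd); lia.
have em : pa d = m.-1 -> pb d < pe d m.-1.
  by move=> am1; have := ltfe m.-1; rewrite prednK ?f0; lia.
have m1E : m.-1.+1 = m by lia.
have e2 : pa d = m.-1 -> pe d m.-1.+1 = n.-1 by move=> <-.
have f0m : pf d m.-1.+1 = pb d by rewrite m1E.
have gmm : pg d m.-1.+1 = n.-1 by rewrite m1E; exact: pg_end vd.
pose e' := if (pa d == m.-1) && (pe d m.-1 == (pb d).+1) then upd (pe d) m.-1 (pb d).+2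
           else pe d.
pose d' := PathData (pa d) (pb d).+1 e' (upd (pf d) m (pb d).+1)
             (upd (pg d) (pa d) (pb d).+1).
have gm := pg_end vd.
have m2E : m.-2.+1 = m.-1 by lia.
have ee : pa d = m.-1 -> pe d m.-2 <= pe d m.-1.
  by move=> ?; rewrite -[X in _ <= pe d X]m2E; apply: (pe_mono vd); lia.
exists d'; split=> //.
- split=> //=.
  + lia.
  + by rewrite /e' /upd; case: ifP => _; rewrite ?(pe_start vd) //; eq_cases; lia.
  + by rewrite /e' /upd; case: ifP => //= /andP[/eqP E _]; case: eqP => ?; lia.
  + move=> i ia; rewrite /e' /upd; have := @pe_mono _ _ _ vd i ia.
    by case: ifP => //= /andP[/eqP E /eqP E1]; upd_cases m d i.
  + by rewrite /upd; case: ifP => [?|_]; [lia | apply: pf_start vd].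
  + by rewrite /upd eqxx.
  + by move=> i ia; rewrite /upd; have := @pf_mono _ _ _ vd i ia; upd_cases m d i.
  + by rewrite /upd eqxx.
  + by rewrite /upd; case: eqP; lia.
  + by move=> i ia; rewrite /upd; have := @pg_mono _ _ _ vd i ia; upd_cases m d i.
  + move=> i ia; have := ltfe i ia; rewrite /e'.
    by case: ifP => [/andP[/eqP E /eqP E1]|/negbT nE]; rewrite /upd; upd_cases m d i.
exists (Ordinal am), (Ordinal bn); split=> //.
apply: cell_setD_x => //= i j im jn.
  rewrite /xcells /in_path /d' /= /upd.
  have gi : pa d <= i < m -> pg d i <= pg d i.+1 by apply: (pg_mono vd).
  by upd_cases m d i.
rewrite /ycells /upper /lower /in_path /d' /= /e'.
have ei : i <= pa d -> pe d i <= pe d i.+1 by apply: (pe_mono vd).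
have fi : 0 < i < m -> pf d i <= pf d i.+1 by apply: (pf_mono vd).
have fei : 0 < i <= pa d -> pf d i.+1 < pe d i by apply: ltfe.
clear d' gm gmm g0 gb.
have e3 : pa d = m.-1 -> pe d m.-2.+1 = pe d m.-1 by rewrite m2E.
rewrite /upd.
have -> : (i == m) = false by lia.
have -> : (i.+1 == m) = (i == m.-1) by lia.
rewrite /e' /upd; case: ifP => [/andP[/eqP E /eqP E1]|_]; last first.
  by case: eqP => // ?; subst i; lia.
have -> : (i.+1 == m.-1) = (i == m.-2) by lia.
by do ![case: eqP => ?] => //; subst i; lia.
Qed.
End Flips.

Section Starts.
Variables m n : nat.
Hypothesis m1 : 1 < m.
Hypothesis n1 : 1 < n.

(* When the upper path, extended to row [a + 1], runs into the lower path (which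
   forces [b = n - 1]), the latter is pushed one column to the left. *)
Lemma start_down d : valid m n d -> pg d (pa d).+1 = pb d ->
    (pa d).+1 < m -> ((pa d).+2 < m) || ((pb d).+1 < n) ->
  exists d', [/\ valid m n d', pa d' = (pa d).+1, pb d' = pb d &
    exists (i : 'I_m) (j : 'I_n), [/\ i = pa d :> nat, j = pb d :> nat &
      path_set m n d :\: path_set m n d' = [set xi i j]]].
Proof.
move=> vd eqb ltam hs.
have am := lt_pa vd; have bn := lt_pb vd.
have ltfe := @pf_lt_pe _ _ _ vd.
have g0 := pg_start vd. have e1 := pe_end vd.
have fb := @pf_bound _ _ _ vd (pa d).+2 ltac:(lia) ltac:(lia).
have fa : pf d (pa d).+1 < n.-1.
  have [a0|a0] := posnP (pa d); last first.
    by have := @pe_bound _ _ _ vd (pa d); have := ltfe (pa d); lia.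
  by rewrite a0 (pf_start vd); lia.
pose f' := if pf d (pa d).+2 == n.-1 then upd (pf d) (pa d).+2 n.-2 else pf d.
pose d' := PathData (pa d).+1 (pb d) (upd (pe d) (pa d).+2 n.-1) f' (pg d).
have f2 : (pa d).+2 < m -> pf d (pa d).+2 <= pf d (pa d).+3 by move=> ?; apply: (pf_mono vd); lia.
have fm : pf d m = pb d := pf_end vd.
exists d'; split=> //.
- split=> //=.
  + exact: pe_start vd.
  + by rewrite /upd eqxx.
  + move=> i ia; rewrite /upd; case: (eqVneq i (pa d).+1) => [->|ne].
      by rewrite eqxx; case: ifP => ?; lia.
    by have := @pe_mono _ _ _ vd i; do ![case: eqP => ?]; lia.
  + by rewrite /f'; case: ifP => _; rewrite /upd ?(pf_start vd).
  + by rewrite /f'; case: eqP => // E; rewrite /upd; case: eqP => // ?; lia.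
  + move=> i ia; rewrite /f'; have := @pf_mono _ _ _ vd i ia.
    by case: eqP => // E; rewrite /upd; eq_cases; lia.
  + exact: pg_end vd.
  + by move=> i ia; apply: (pg_mono vd); lia.
  + move=> i ia; have := ltfe i; rewrite /f' /upd.
    have [->|ne] := eqVneq i (pa d).+1; last by case: eqP => // ?; do ![case: eqP => ?]; lia.
    by case: eqP => E; rewrite ?eqxx; do ?[case: eqP => ?]; lia.
exists (Ordinal am), (Ordinal bn); split=> //.
apply: cell_setD_x => //= i j im jn.
  rewrite /xcells /in_path /d' /=.
  have gi : pa d <= i < m -> pg d i <= pg d i.+1 by apply: (pg_mono vd).
  have [?|?] := eqVneq i (pa d); last by lia.
  by subst i; lia.
rewrite /ycells /upper /lower /in_path /d' /= /f'.
have ei : i <= pa d -> pe d i <= pe d i.+1 by apply: (pe_mono vd).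
have fi : 0 < i < m -> pf d i <= pf d i.+1 by apply: (pf_mono vd).
have fei : 0 < i <= pa d -> pf d i.+1 < pe d i by apply: ltfe.
clear d' f'; case: eqP => [E|_]; rewrite /upd; last first.
  have -> : (i.+1 == (pa d).+2) = (i == (pa d).+1) by lia.
  by do ![case: eqP => ?] => //; subst; lia.
have -> : (i.+1 == (pa d).+2) = (i == (pa d).+1) by lia.
have [?|?] := eqVneq i (pa d).+1; first by subst i; case: eqP => ?; lia.
by have [?|?] := eqVneq i (pa d).+2; [subst i|]; lia.
Qed.

(** The x-path consists of the last two cells of the last column and cannot be shortened. It is
    replaced by the last two cells of the last row: as many cells, but fewer rows below the first
    one. The y-cell (m-1, n-1) passes from the lower path to the upper one. *)
Lemma start_last d : valid m n d -> pa d = m.-2 -> pb d = n.-1 ->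
  exists d', [/\ valid m n d', pa d' = m.-1, pb d' = n.-2 &
    exists (i : 'I_m) (j : 'I_n), [/\ i = pa d :> nat, j = pb d :> nat &
      path_set m n d :\: path_set m n d' = [set xi i j]]].
Proof.
move=> vd Ea Eb.
have am := lt_pa vd; have bn := lt_pb vd.
have ltfe := @pf_lt_pe _ _ _ vd.
have e1 := pe_end vd. have fm := pf_end vd.
have m2E : m.-2.+1 = m.-1 by lia.
have m1E : m.-1.+1 = m by lia.
have fa : pf d m.-1 < n.-1.
  have [a0|a0] := posnP (pa d); last first.
    have := @pe_bound _ _ _ vd (pa d); have := ltfe (pa d).
    by rewrite Ea m2E; lia.
  have -> : m.-1 = 1 by lia.
  by rewrite (pf_start vd); lia.
pose d' := PathData m.-1 n.-2 (upd (pe d) m n.-1) (upd (pf d) m n.-2)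
             (fun i => if i == m.-1 then n.-2 else n.-1).
have em : pe d m.-1 = n.-1 by rewrite -e1 Ea m2E.
have gm : pg d m.-1 = n.-1.
  by have := @pg_bound _ _ _ vd m.-1; lia.
exists d'; split=> //.
- split=> //=.
  + lia.
  + lia.
  + by rewrite /upd; case: eqP => [?|_]; [lia | exact: pe_start vd].
  + by rewrite /upd m1E eqxx.
  + move=> i ia; rewrite /upd.
    have [->|ne] := eqVneq i m.-1; first by rewrite m1E eqxx em; case: eqP => ?; lia.
    by have := @pe_mono _ _ _ vd i; do ![case: eqP => ?]; lia.
  + by rewrite /upd; case: ifP => [?|_]; [lia | exact: pf_start vd].
  + by rewrite /upd eqxx.
  + move=> i ia; rewrite /upd; have := @pf_mono _ _ _ vd i.
    have [->|ne] := eqVneq i m.-1; first by rewrite m1E eqxx; case: eqP => ?; lia.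
    by do ![case: eqP => ?]; lia.
  + by rewrite eqxx.
  + by case: eqP => ?; lia.
  + move=> i ia; have -> : i = m.-1 by lia.
    by rewrite eqxx; case: eqP => ?; lia.
  + move=> i ia; have := ltfe i; rewrite /upd.
    have [->|ne] := eqVneq i m.-1; first by rewrite m1E eqxx em; case: eqP => ?; lia.
    by do ![case: eqP => ?]; lia.
exists (Ordinal am), (Ordinal bn); split=> //.
apply: cell_setD_x => //= i j im jn.
  rewrite /xcells /in_path /d' /=.
  have [?|ne] := eqVneq i m.-1.
    by subst i; rewrite m1E gm (pg_end vd); case: eqP => ?; lia.
  have [?|?] := eqVneq i m.-2; last by lia.
  by subst i; rewrite m2E gm -Ea (pg_start vd); lia.
rewrite /ycells /upper /lower /in_path /d' /= /upd.
have ei : i <= pa d -> pe d i <= pe d i.+1 by apply: (pe_mono vd).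
have fi : 0 < i < m -> pf d i <= pf d i.+1 by apply: (pf_mono vd).
have -> : (i == m) = false by lia.
have -> : (i.+1 == m) = (i == m.-1) by lia.
have [?|?] := eqVneq i m.-1; last by lia.
by subst i; rewrite m1E fm em; lia.
Qed.

Lemma key_start d d' : valid m n d -> valid m n d' ->
  (m.-1 - pa d' + (n.-1 - pb d')) * m + (m.-1 - pa d') <
  (m.-1 - pa d + (n.-1 - pb d)) * m + (m.-1 - pa d) -> key m n d' < key m n d.
Proof.
move=> vd vd' lt; have := area_bound m1 vd'; rewrite /key.
set M := m.+1 * _; move: lt; set p := _ * m + _; set q := _ * m + _ => lt ltM.
have : p.+1 * M <= q * M by rewrite leq_mul2r lt orbT.
by rewrite mulSn; lia.
Qed.

Lemma key_leq_pa d d' : valid m n d -> valid m n d' -> key m n d' <= key m n d ->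
  (m.-1 - pa d' + (n.-1 - pb d')) * m + (m.-1 - pa d') <=
  (m.-1 - pa d + (n.-1 - pb d)) * m + (m.-1 - pa d).
Proof.
by move=> vd vd'; rewrite leqNgt => h; rewrite leqNgt; apply: contra h; apply: key_start.
Qed.

Lemma key_area d d' : pa d = pa d' -> pb d = pb d' ->
  (key m n d <= key m n d') = (area m d <= area m d').
Proof. by move=> Ea Eb; rewrite /key Ea Eb leq_add2l. Qed.

Lemma key_area_lt d d' : pa d = pa d' -> pb d = pb d' ->
  (key m n d < key m n d') = (area m d < area m d').
Proof. by move=> Ea Eb; rewrite /key Ea Eb ltn_add2l. Qed.
End Starts.

Section Exchange.
Variables m n : nat.
Hypothesis m1 : 1 < m.
Hypothesis n1 : 1 < n.

(** Minimality of k + 1 is the point: for monotone [h'] one gets h k <= h' k <= h' (k+1) < h (k+1),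
    so [h] has a corner in row k, at a cell off the path of [h']. *)
Lemma first_descent (h h' : nat -> nat) (r0 r1 : nat) : h r0 <= h' r0 ->
  (exists k, [&& r0 <= k, k <= r1 & h' k < h k]) ->
  exists k, [/\ r0 <= k, k.+1 <= r1, h k <= h' k & h' k.+1 < h k.+1].
Proof.
move=> le0 ex; case: (ex_minnP ex) => k /and3P[r0k kr1 lt] mink.
case: k => [|k] in r0k kr1 lt mink *; first by move: le0 lt; have -> : r0 = 0; lia.
have [r0E|ne] := eqVneq r0 k.+1; first by subst r0; lia.
exists k; split=> //; first by lia.
by rewrite leqNgt; apply/negP => lt'; have := mink k; rewrite lt'; lia.
Qed.

Lemma path_set_eq c d : pa c = pa d -> (forall i, i <= (pa d).+1 -> pe c i = pe d i) ->
  (forall i, 0 < i <= m -> pf c i = pf d i) ->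
  (forall i, pa d <= i <= m -> pg c i = pg d i) -> path_set m n c = path_set m n d.
Proof.
move=> Ea Ee Ef Eg; apply/setP => v.
case: (cellP v) => [][i [j ->]]; rewrite ?mem_cell_y ?mem_cell_x.
  rewrite /ycells /upper /lower /in_path Ea; congr (_ || _).
    by case: (leqP i (pa d)) => ia; rewrite ?andbF //= !Ee //; lia.
  by case: (posnP i) => // i0; rewrite !Ef //; have := ltn_ord i; lia.
rewrite /xcells /in_path Ea; case: (leqP (pa d) i) => //= ia.
by rewrite !Eg //; have := ltn_ord i; lia.
Qed.

(** Wherever a path of [d] exceeds the corresponding path of [c], its first such corner is flipped.
    The upper path comes first: pe d <= pe c then keeps the cell lost by the lower path of [d] off
    the upper path of [c]. If nothing exceeds, the areas force equality. *)
Lemma exchange_same c d : valid m n c -> valid m n d -> pa c = pa d -> pb c = pb d ->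
  area m c <= area m d -> path_set m n c <> path_set m n d ->
  exists v d', [/\ valid m n d', key m n d' < key m n d,
    v \in path_set m n d :\: path_set m n c &
    path_set m n d :\: path_set m n d' = [set v]].
Proof.
move=> vc vd Ea Eb lea neq.
have amd := lt_pa vd.
have memP (v : 'I_(m * n + m * n)) (d' : path_data) :
    path_set m n d :\: path_set m n d' = [set v] ->
    v \notin path_set m n c -> v \in path_set m n d :\: path_set m n c.
  move=> E vn; have : v \in [set v] by rewrite inE.
  by rewrite -E !in_setD => /andP[_ ->]; rewrite vn.
have [exe|le_e] := boolP [exists k : 'I_(pa d).+1, pe c k < pe d k].
  have [||k [_ ka lek ltk]] := @first_descent (pe d) (pe c) 0 (pa d).
  - by rewrite (pe_start vc) (pe_start vd).
  - by case/existsP: exe => k ltk; exists k; rewrite ltk /= andbT; have := ltn_ord k; lia.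
  have ltfe := @pf_lt_pe _ _ _ vc k.+1 ltac:(lia).
  have := @pe_mono _ _ _ vc k ltac:(lia) => ck.
  have [|||d' [vd' Ea' Eb' lt' [i [j [Ei Ej E]]]]] := @flip_upper m n m1 d k vd ka; try lia.
    (* For k + 2 = m, pf d m = pf c m < pe c (k+1) < pe d (k+1), so the lower path need not be
       pushed. *)
    case: (ltnP k.+2 m) => //= km; have k2 : k.+2 = m by lia.
    by move: ltfe; rewrite k2 (pf_end vd) (pf_end vc); lia.
  exists (yi i j), d'; split=> //; first by rewrite key_area_lt.
  apply: memP E _; rewrite mem_cell_y Ei Ej /ycells /upper /lower /in_path.
  rewrite negb_or; apply/andP; split; first by lia.
  case: (posnP k) => k0; first by rewrite k0.
  by have := @pf_lt_pe _ _ _ vc k ltac:(lia); lia.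
have {}le_e k : k <= pa d -> pe d k <= pe c k.
  move=> ka; rewrite leqNgt; apply: contra le_e => lt; apply/existsP.
  by have ka' : k < (pa d).+1 by []; exists (Ordinal ka').
have [exf|le_f] := boolP [exists k : 'I_m, (0 < k) && (pf c k < pf d k)].
  have [||k [k0 km lek ltk]] := @first_descent (pf d) (pf c) 1 m.-1.
  - by rewrite (pf_start vc) (pf_start vd).
  - by case/existsP: exf => k /andP[k0 ltk]; exists k; rewrite ltk k0 /=; have := ltn_ord k; lia.
  have := @pf_mono _ _ _ vc k ltac:(lia) => ck.
  have [||d' [vd' Ea' Eb' lt' [i [j [Ei Ej E]]]]] := @flip_lower m n m1 d k vd k0; try lia.
  exists (yi i j), d'; split=> //; first by rewrite key_area_lt.
  apply: memP E _; rewrite mem_cell_y Ei Ej /ycells /upper /lower /in_path.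
  rewrite negb_or; apply/andP; split; last by lia.
  case: (leqP k (pa c)) => //= kc.
  by have := @pf_lt_pe _ _ _ vd k ltac:(lia); have := le_e k; lia.
have {}le_f k : 0 < k <= m -> pf d k <= pf c k.
  move=> k0; have [->|km] := eqVneq k m; first by rewrite (pf_end vd) (pf_end vc) Eb.
  rewrite leqNgt; apply: contra le_f => lt; apply/existsP.
  by have km' : k < m by [lia]; exists (Ordinal km'); rewrite /= lt andbT; lia.
have [exg|le_g] := boolP [exists k : 'I_m, (pa d <= k) && (pg c k < pg d k)].
  have [||k [k0 km lek ltk]] := @first_descent (pg d) (pg c) (pa d) m.-1.
  - by rewrite (pg_start vd) -Ea (pg_start vc) Eb.
  - by case/existsP: exg => k /andP[k0 ltk]; exists k; rewrite ltk k0 /=; have := ltn_ord k; lia.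
  have := @pg_mono _ _ _ vc k ltac:(lia) => ck.
  have [||d' [vd' Ea' Eb' lt' [i [j [Ei Ej E]]]]] := @flip_x m n m1 d k vd k0; try lia.
  exists (xi i j), d'; split=> //; first by rewrite key_area_lt.
  by apply: memP E _; rewrite mem_cell_x Ei Ej /xcells /in_path; lia.
have {}le_g k : pa d <= k <= m -> pg d k <= pg c k.
  move=> k0; have [->|km] := eqVneq k m; first by rewrite (pg_end vd) (pg_end vc).
  rewrite leqNgt; apply: contra le_g => lt; apply/existsP.
  by have km' : k < m by [lia]; exists (Ordinal km'); rewrite /= lt andbT; lia.
case: neq.
have le_corner i : i <= m -> corner_sum m d i <= corner_sum m c i.
  move=> im; rewrite /corner_sum Ea; have := le_e i; have := le_f i; have := le_g i.
  by do ![case: ifP => ?]; lia.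
have eq_corner := area_eq m1 le_corner lea.
apply: path_set_eq => // i ib.
- have [->|ia] := eqVneq i (pa d).+1; first by rewrite (pe_end vd) -Ea (pe_end vc).
  have [->|i0] := posnP i; first by rewrite (pe_start vd) (pe_start vc).
  have := eq_corner i ltac:(lia); rewrite /corner_sum Ea.
  have := le_e i; have := le_f i; have := le_g i.
  by do ![case: ifP => ?]; lia.
- have [->|im] := eqVneq i m; first by rewrite (pf_end vd) (pf_end vc).
  have [->|i0] := eqVneq i 1; first by rewrite (pf_start vd) (pf_start vc).
  have := eq_corner i ltac:(lia); rewrite /corner_sum Ea.
  have := le_e i; have := le_f i; have := le_g i.
  by do ![case: ifP => ?]; lia.
have [->|im] := eqVneq i m; first by rewrite (pg_end vd) (pg_end vc).
have [->|i0] := eqVneq i (pa d); first by rewrite (pg_start vd) -Ea (pg_start vc).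
have := eq_corner i ltac:(lia); rewrite /corner_sum Ea.
have := le_e i; have := le_f i; have := le_g i.
by do ![case: ifP => ?]; lia.
Qed.

(** If the first x-cell of [d] is on the x-path of [c], then [c] starts weakly above and to the
    left, and the order of keys forces equal starts. Otherwise the first x-cell of [d] is the vertex
    to remove. *)
Lemma exchange c d : valid m n c -> valid m n d ->
  path_set m n c <> path_set m n d -> key m n c <= key m n d ->
  exists v d', [/\ valid m n d', key m n d' < key m n d,
    v \in path_set m n d :\: path_set m n c &
    path_set m n d :\: path_set m n d' = [set v]].
Proof.
move=> vc vd neq lek.
have am := lt_pa vd; have bn := lt_pb vd.
have ac := lt_pa vc; have bc := lt_pb vc.
have lep := key_leq_pa m1 n1 vd vc lek.
have [xc|xnc] := boolP (xcells m c (pa d) (pb d)).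
  case/and4P: xc => [lea _ leb _].
  have lebb : pb c <= pb d.
    by apply: leq_trans leb; have := @pg_bound _ _ _ vc (pa d); lia.
  have : (m.-1 - pa c + (n.-1 - pb c)) * m <= (m.-1 - pa d + (n.-1 - pb d)) * m.
    rewrite leqNgt; apply/negP => lt.
    have : (m.-1 - pa d + (n.-1 - pb d)).+1 * m <= (m.-1 - pa c + (n.-1 - pb c)) * m.
      by rewrite leq_mul2r; apply/orP; right; rewrite -(ltn_pmul2r (m := m)) //; lia.
    by rewrite mulSn; lia.
  rewrite leq_pmul2r; last by lia.
  move=> les; apply: exchange_same => //; try lia.
  by rewrite -(key_area m n) //; lia.
have memv (i : 'I_m) (j : 'I_n) (d' : path_data) : i = pa d :> nat -> j = pb d :> nat ->
    path_set m n d :\: path_set m n d' = [set xi i j] ->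
    xi i j \in path_set m n d :\: path_set m n c.
  move=> Ei Ej E; have : xi i j \in [set xi i j] by rewrite inE.
  by rewrite -E !in_setD => /andP[_ ->]; rewrite mem_cell_x Ei Ej xnc.
have gb : pb d <= pg d (pa d).+1 by rewrite -(pg_start vd); apply: (pg_mono vd); lia.
have ne := start_neq_end vd m1.
have [le|gt] := leqP (pg d (pa d).+1) (pb d).
  have {le gb}ge : pg d (pa d).+1 = pb d by lia.
  have am1 : (pa d).+1 < m.
    rewrite ltnNge; apply/negP => ma; have Em : (pa d).+1 = m by lia.
    by move: ge; rewrite Em (pg_end vd); lia.
  have [hs|hs] := boolP (((pa d).+2 < m) || ((pb d).+1 < n)).
    have [d' [vd' Ea Eb [i [j [Ei Ej E]]]]] := start_down m1 n1 vd ge am1 hs.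
    exists (xi i j), d'; split=> //; last exact: memv E.
    by apply: key_start => //; rewrite Ea Eb; nia.
  have [||d' [vd' Ea Eb [i [j [Ei Ej E]]]]] := start_last m1 n1 vd; try lia.
  exists (xi i j), d'; split=> //; last exact: memv E.
  by apply: key_start => //; rewrite Ea Eb; nia.
have [hs|hs] := boolP (((pa d).+1 < m) || ((pb d).+2 < n)).
  have bn1 : (pb d).+1 < n by have := @pg_bound _ _ _ vd (pa d).+1; lia.
  have [d' [vd' Ea Eb [i [j [Ei Ej E]]]]] := start_right m1 vd gt hs.
  exists (xi i j), d'; split=> //; last exact: memv E.
  by apply: key_start => //; rewrite Ea Eb; nia.
have nec := start_neq_end vc m1.
(* Here [d] starts at (m-1, n-2). Since the corner is excluded as a start, this is the least start
   for the key, so [c] starts there too. *)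
have [Eac Ebc] : pa c = m.-1 /\ pb c = n.-2.
  move: lep; have -> : m.-1 - pa d + (n.-1 - pb d) = 1 by lia.
  have -> : m.-1 - pa d = 0 by lia.
  case: (ltnP 1 (m.-1 - pa c + (n.-1 - pb c))) => sc; last first.
    by case: (ltngtP (m.-1 - pa c + (n.-1 - pb c)) 1) => [||->]; lia.
  by have : 2 * m <= (m.-1 - pa c + (n.-1 - pb c)) * m by [rewrite leq_mul2r sc orbT]; lia.
case/negP: xnc; have [Ea Eb] : pa d = m.-1 /\ pb d = n.-2 by lia.
have gs : pg c m.-1 = n.-2 by rewrite -Eac (pg_start vc).
have m1E : m.-1.+1 = m by lia.
by rewrite /xcells /in_path Ea Eb m1E gs (pg_end vc); lia.
Qed.
End Exchange.

(** * Cardinality of a triple of paths *)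

Section Card.
Variables m n : nat.

Lemma big_mxvec_index (R : Type) (idx : R) (op : Monoid.com_law idx) (F : 'I_(m * n) -> R) :
  \big[op/idx]_k F k = \big[op/idx]_(i < m) \big[op/idx]_(j < n) F (mxvec_index i j).
Proof.
by rewrite (reindex _ (curry_mxvec_bij m n)) pair_bigA; apply: eq_bigr => [[i j]].
Qed.

Lemma card_cell_set py px : #|cell_set m n py px| =
  \sum_(i < m) \sum_(j < n) py i j + \sum_(i < m) \sum_(j < n) px i j.
Proof.
rewrite -sum1_card big_mkcond big_split_ord /= !big_mxvec_index.
congr (_ + _); apply: eq_bigr => i _; apply: eq_bigr => j _.
  by rewrite [_ \in _](mem_cell_y py px i j); case: (py i j).
by rewrite [_ \in _](mem_cell_x py px i j); case: (px i j).
Qed.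

Lemma sum_interval h h' : h <= h' < n -> \sum_(j < n) (h <= j <= h') = h'.+1 - h.
Proof.
move=> /andP[le lt]; rewrite -(big_mkord xpredT (fun j => nat_of_bool (h <= j <= h'))).
rewrite (@big_cat_nat _ _ _ h) //=; last by lia.
rewrite (@big_cat_nat _ _ _ h'.+1 h n) //=; last by lia.
rewrite !big_nat.
rewrite big1 => [|i ?]; last by rewrite leqNgt; case: ltnP => //; lia.
rewrite [X in _ + (_ + X)]big1 => [|i ?]; last first.
  by rewrite [i <= h']leqNgt; case: ltnP; rewrite ?andbF //; lia.
rewrite (eq_bigr (fun=> 1)) => [|i ?]; last by have -> : h <= i <= h' by lia.
by rewrite -big_nat sum_nat_const_nat; lia.
Qed.

Lemma sum_in_path h r0 r1 : r0 <= r1 < m -> (forall i, r0 <= i <= r1 -> h i <= h i.+1) ->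
  h r1.+1 < n ->
  \sum_(i < m) \sum_(j < n) in_path r0 r1 h i j + h r0 = h r1.+1 + (r1.+1 - r0).
Proof.
move=> /andP[le lt] hm hn.
rewrite -(big_mkord xpredT (fun i => \sum_(j < n) in_path r0 r1 h i j)).
have out i : ~~ (r0 <= i <= r1) -> \sum_(j < n) in_path r0 r1 h i j = 0.
  by move=> ni; rewrite big1 // => j _; rewrite /in_path andbA (negbTE ni).
have inn i : r0 <= i <= r1 -> \sum_(j < n) in_path r0 r1 h i j = (h i.+1).+1 - h i.
  move=> ri; rewrite -(sum_interval (h := h i)).
    by apply: eq_bigr => j _; rewrite /in_path andbA ri.
  rewrite hm //=; apply: leq_ltn_trans hn.
  by apply: (mono_leq (r0 := r0) (r1 := r1.+1)); try lia; move=> k ?; apply: hm; lia.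
rewrite (@big_cat_nat _ _ _ r0) //=; last by lia.
rewrite (@big_cat_nat _ _ _ r1.+1 r0 m) //=; last by lia.
rewrite !big_nat big1 => [|i ?]; last by apply: out; lia.
rewrite [X in _ + (_ + X)]big1 => [|i ?]; last by apply: out; lia.
rewrite (eq_bigr (fun i => (h i.+1).+1 - h i)) => [|i ?]; last by apply: inn; lia.
rewrite -big_nat add0n addn0.
elim: r1 le {lt hn out inn} hm => [|r1 IH] le hm.
  by have -> : r0 = 0 by [lia]; rewrite big_nat1; have := hm 0; lia.
have [E|ne] := eqVneq r0 r1.+1; first by subst r0; rewrite big_nat1; have := hm r1.+1; lia.
rewrite big_nat_recr /=; last by lia.
have {}IH := IH ltac:(lia) (fun i hi => hm i ltac:(lia)).
by have := hm r1.+1; move: IH; set S := \sum_(_ <= _ < _) _; lia.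
Qed.

(** The upper, lower and x-paths have pa + n, pb + m - 1 and (m - pa) + (n - 1 - pb) cells: the
    dependence on the start cancels. *)
Lemma card_path_set d : 1 < m -> valid m n d -> #|path_set m n d| + 2 = 2 * (m + n).
Proof.
move=> m1 vd; have am := lt_pa vd; have bn := lt_pb vd.
have m1E : m.-1.+1 = m by lia.
have ltfe := @pf_lt_pe _ _ _ vd.
have eb := @pe_bound _ _ _ vd. have fb := @pf_bound _ _ _ vd.
have mono_f i : 1 <= i <= m.-1 -> pf d i <= pf d i.+1 by move=> ?; apply: (pf_mono vd); lia.
have mono_g i : pa d <= i <= m.-1 -> pg d i <= pg d i.+1 by move=> ?; apply: (pg_mono vd); lia.
have := @sum_in_path (pe d) 0 (pa d) am (fun i h => pe_mono vd h).
have := @sum_in_path (pf d) 1 m.-1 _ mono_f.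
have := @sum_in_path (pg d) (pa d) m.-1 _ mono_g.
rewrite m1E (pe_start vd) (pe_end vd) (pf_start vd) (pf_end vd) (pg_start vd) (pg_end vd).
move=> /(_ ltac:(lia) ltac:(lia)) Sg /(_ ltac:(lia) ltac:(lia)) Sf /(_ ltac:(lia)) Se.
rewrite card_cell_set (_ : \sum_(i < m) \sum_(j < n) ycells m d i j =
    \sum_(i < m) \sum_(j < n) in_path 0 (pa d) (pe d) i j +
    \sum_(i < m) \sum_(j < n) in_path 1 m.-1 (pf d) i j); first by rewrite /xcells; lia.
rewrite -big_split; apply: eq_bigr => i _; rewrite -big_split; apply: eq_bigr => j _ /=.
rewrite /ycells /upper /lower /in_path; have := ltfe i.
by case: (leqP i (pa d)); case: posnP; lia.
Qed.
End Card.

(** * Maximal sets avoiding the generators *)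

Section Extension.
Variables m n : nat.
Hypothesis m1 : 1 < m.
Hypothesis n1 : 1 < n.

(* No monomial of type A, B, C, D or E (with indices from [0]) is supported on
   the y-cells [py] and the x-cells [px]. *)
Record standard (py px : nat -> nat -> bool) : Prop := Standard {
  std_y : forall i j, py i j -> i < m /\ j < n;
  std_x : forall i j, px i j -> i < m /\ j < n;
  std_A : forall i j k l, px i l -> px j k -> i < j -> k < l -> False;
  std_B : forall i j k l, px i k -> py j l -> i < j -> k < l -> False;
  std_C : forall i j k p q r, px k p -> py j q -> py i r -> i < j -> j <= k ->
    p < q -> q < r -> False;
  std_D : forall i j k p q r, px i r -> py j q -> py k p -> i < j -> j < k ->
    p < q -> q <= r -> False;
  std_E : forall i j k p q r, py i r -> py j q -> py k p -> i < j -> j < k ->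
    p < q -> q < r -> False
}.

Definition add_cell (p : nat -> nat -> bool) (i0 j0 i j : nat) : bool :=
  p i j || (i == i0) && (j == j0).

Lemma add_cellP p i0 j0 i j : add_cell p i0 j0 i j -> p i j \/ i = i0 /\ j = j0.
Proof. by case/orP => [|/andP[/eqP-> /eqP->]]; [left|right]. Qed.

(* [0] if [p] has no cell in the rows above [i]. *)
Definition colmax (p : nat -> nat -> bool) (i : nat) : nat :=
  \max_(i' < i) \max_(j < n | p i' j) j.

Lemma colmax_leq (p : nat -> nat -> bool) i B :
  (forall i' j, i' < i -> p i' j -> j <= B) -> colmax p i <= B.
Proof.
move=> H; apply/bigmax_leqP => i' _; apply/bigmax_leqP => j pj.
exact: H (ltn_ord i') pj.
Qed.

Lemma leq_colmax (p : nat -> nat -> bool) i i' j : i' < i -> j < n -> p i' j -> j <= colmax p i.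
Proof.
move=> li lj pj; apply: (@leq_trans (\max_(j < n | p i' j) j)).
  exact: (@leq_bigmax_cond _ (fun j : 'I_n => p i' j) (fun j : 'I_n => nat_of_ord j) (Ordinal lj)).
exact: (@leq_bigmax _ (fun i' : 'I_i => \max_(j < n | p i' j) j) (Ordinal li)).
Qed.

Lemma colmax_mono p i : colmax p i <= colmax p i.+1.
Proof.
apply/bigmax_leqP => i' _; apply/bigmax_leqP => j pj.
by apply: (leq_colmax _ _ pj) => //; apply: ltnW; rewrite ltnS.
Qed.

Lemma ltn_colmax (p : nat -> nat -> bool) i j :
  j < colmax p i -> exists i' j', [/\ i' < i, j < j' & p i' j'].
Proof.
move=> lt; apply: NNPP => ne; move: lt; rewrite ltnNge => /negP; apply.
apply: colmax_leq => i' j' li pj; rewrite leqNgt; apply/negP => lt.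
by apply: ne; exists i', j'.
Qed.

Variables py px : nat -> nat -> bool.
Hypothesis std : standard py px.
Hypothesis max_y : forall i0 j0, i0 < m -> j0 < n ->
  standard (add_cell py i0 j0) px -> py i0 j0.
Hypothesis max_x : forall i0 j0, i0 < m -> j0 < n ->
  standard py (add_cell px i0 j0) -> px i0 j0.

Let hy := std_y std. Let hx := std_x std. Let hA := std_A std. Let hB := std_B std.
Let hC := std_C std. Let hD := std_D std. Let hE := std_E std.

(** This variable divides no generator. *)
Lemma max_x_corner : px m.-1 n.-1.
Proof.
apply: max_x; try lia; split=> //.
- by move=> i j /add_cellP[/hx//|]; lia.
- move=> i j k l /add_cellP[x1|[? ?]] /add_cellP[x2|[? ?]]; try (exact: hA x1 x2); subst; try lia.
  + by have := hx x1; lia.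
  + by have := hx x2; lia.
- move=> i j k l /add_cellP[x1|[? ?]] y; first exact: hB x1 y.
  by have := hy y; lia.
- move=> i j k p q r /add_cellP[x1|[? ?]] y1 y2; first exact: hC x1 y1 y2.
  by have := hy y2; lia.
- move=> i j k p q r /add_cellP[x1|[? ?]] y1 y2; first exact: hD x1 y1 y2.
  by have := hy y2; lia.
Qed.

(** With a the first row and b the first column that contain x-cells, type A forces (a, b) itself to
    be an x-cell. *)
Lemma max_x_min : exists a b, [/\ px a b, a < m.-1 \/ b < n.-1 &
  forall i j, px i j -> a <= i /\ b <= j].
Proof.
pose rowx i := [exists j : 'I_n, px i j]; pose colx j := [exists i : 'I_m, px i j].
have rowP i j : px i j -> rowx i.
  by move=> xij; have [_ lj] := hx xij; apply/existsP; exists (Ordinal lj).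
have colP i j : px i j -> colx j.
  by move=> xij; have [li _] := hx xij; apply/existsP; exists (Ordinal li).
have ea : exists i, rowx i by exists m.-1; apply: rowP max_x_corner.
have eb : exists j, colx j by exists n.-1; apply: colP max_x_corner.
case: (ex_minnP ea) => a /existsP[j xaj] mina.
case: (ex_minnP eb) => b /existsP[i xib] minb.
have min i' j' : px i' j' -> a <= i' /\ b <= j'.
  by move=> x'; split; [apply: mina; apply: rowP x' | apply: minb; apply: colP x'].
have [lai lbj] : a <= i /\ b <= j.
  by split; [apply: mina; apply: rowP xib | apply: minb; apply: colP xaj].
have xab : px a b.
  have [Ei|ni] := eqVneq a i; first by rewrite Ei.
  have [Ej|nj] := eqVneq b j; first by rewrite Ej.
  by case: (hA xaj xib); lia.
exists a, b; split=> //.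
have [la lb] := hx xab.
case: (ltnP a m.-1) => la1; first by left.
case: (ltnP b n.-1) => lb1; first by right.
(* Otherwise the corner is the only x-cell, and then (m-2, n-1) can be added. *)
suff /min : px m.-2 n.-1 by lia.
have only i' j' : px i' j' -> i' = m.-1 /\ j' = n.-1.
  by move=> x'; have := min _ _ x'; have := hx x'; lia.
apply: max_x; try lia; split=> //.
- by move=> i' j' /add_cellP[/hx//|]; lia.
- move=> i' j' k l /add_cellP[x1|[? ?]] /add_cellP[x2|[? ?]]; try (exact: hA x1 x2); subst; try lia.
  + by have := only _ _ x1; lia.
  + by have := only _ _ x2; lia.
- move=> i' j' k l /add_cellP[x1|[? ?]] y; first exact: hB x1 y.
  by have := hy y; lia.
- move=> i' j' k p q r /add_cellP[x1|[? ?]] y1 y2; first exact: hC x1 y1 y2.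
  by have := hy y2; lia.
- move=> i' j' k p q r /add_cellP[x1|[? ?]] y1 y2; first exact: hD x1 y1 y2.
  by have := hy y2; lia.
Qed.

(** The variable y_(0,1) divides no generator. *)
Lemma max_y_first : exists j, 0 < j /\ py 0 j.
Proof.
exists 1; split=> //; apply: max_y; try lia; split=> //.
- by move=> i' j' /add_cellP[/hy//|]; lia.
- move=> i j k l x /add_cellP[y|[? ?]]; first exact: hB x y.
  by lia.
- move=> i j k p q r x /add_cellP[y1|[? ?]] /add_cellP[y2|[? ?]]; try lia.
  exact: hC x y1 y2.
- move=> i j k p q r x /add_cellP[y1|[? ?]] /add_cellP[y2|[? ?]]; try lia.
  exact: hD x y1 y2.
- move=> i j k p q r /add_cellP[y0|[? ?]] /add_cellP[y1|[? ?]] /add_cellP[y2|[? ?]]; try lia.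
  exact: hE y0 y1 y2.
Qed.

Section Min.
Variables a b : nat.
Hypothesis xab : px a b.
Hypothesis ab_ne : a < m.-1 \/ b < n.-1.
Hypothesis min_ab : forall i j, px i j -> a <= i /\ b <= j.

Lemma y_outside i j : py i j -> i <= a \/ j <= b.
Proof.
move=> y; case: (leqP i a) => ia; first by left.
by case: (leqP j b) => jb; [right | case: (hB xab y)].
Qed.

(** This is the last cell of the lower path. A new monomial of type E through it would yield, with
    [xab], one of type C among the old cells. *)
Lemma max_y_bottom : py m.-1 b.
Proof.
have [la lb] := hx xab.
apply: max_y; try lia; split=> //.
- by move=> i' j' /add_cellP[/hy//|]; lia.
- move=> i j k l x /add_cellP[y|[? ?]]; first exact: hB x y.
  by have := min_ab x; lia.
- move=> i j k p q r x /add_cellP[y1|[? ?]] /add_cellP[y2|[? ?]]; try exact: hC x y1 y2.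
  + by have := hy y1; lia.
  + by have := min_ab x; lia.
  + by lia.
- move=> i j k p q r x /add_cellP[y1|[? ?]] /add_cellP[y2|[? ?]]; try exact: hD x y1 y2.
  + by have := min_ab x; have := y_outside y1; lia.
  + by have := hy y2; lia.
  + by lia.
- move=> i j k p q r /add_cellP[y0|[? ?]] /add_cellP[y1|[? ?]] /add_cellP[y2|[? ?]];
    try exact: hE y0 y1 y2.
  + move=> ij jk pq qr; have := y_outside y1; case: (leqP j a) => ja; last by lia.
    by move=> _; apply: (hC xab y1 y0); lia.
  + by have := hy y2; lia.
  + by lia.
  + by have := hy y1; lia.
  + by have := hy y1; lia.
  + by lia.
  + by lia.
Qed.

(** This is the last cell of the upper path. A new monomial of type E through it would yield, with
    [xab], one of type D among the old cells. *)
Lemma max_y_right : py a n.-1.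
Proof.
have [la lb] := hx xab.
apply: max_y; try lia; split=> //.
- by move=> i' j' /add_cellP[/hy//|]; lia.
- move=> i j k l x /add_cellP[y|[? ?]]; first exact: hB x y.
  by have := min_ab x; lia.
- move=> i j k p q r x /add_cellP[y1|[? ?]] /add_cellP[y2|[? ?]]; try exact: hC x y1 y2.
  + by have := min_ab x; have := y_outside y1; lia.
  + by have := hy y2; lia.
  + by lia.
- move=> i j k p q r x /add_cellP[y1|[? ?]] /add_cellP[y2|[? ?]]; try exact: hD x y1 y2.
  + by have := hy y1; lia.
  + by have := min_ab x; lia.
  + by lia.
- move=> i j k p q r /add_cellP[y0|[? ?]] /add_cellP[y1|[? ?]] /add_cellP[y2|[? ?]];
    try exact: hE y0 y1 y2.
  + by have := hy y1; lia.
  + by have := hy y0; lia.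
  + by lia.
  + move=> ij jk pq qr; have := y_outside y1; case: (leqP q b) => qb; last by lia.
    by move=> _; apply: (hD xab y1 y2); lia.
  + by lia.
  + by lia.
  + by lia.
Qed.

(** Needed for (m-1, b) to count as a cell of the lower path when a = m - 1. If there were no such
    cell, (m-2, b+1) could be added. *)
Lemma max_y_above : a = m.-1 -> exists i j, [/\ i < m.-1, b < j & py i j].
Proof.
move=> am; apply: NNPP => ne.
have none i j : py i j -> i < m.-1 -> j <= b.
  by move=> y im; rewrite leqNgt; apply/negP => bj; apply: ne; exists i, j.
have [la lb] := hx xab.
apply: ne; exists m.-2, b.+1; split=> //; first by lia.
apply: max_y; try lia; split=> //.
- by move=> i' j' /add_cellP[/hy//|]; lia.
- move=> i j k l x /add_cellP[y|[? ?]]; first exact: hB x y.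
  by have := min_ab x; lia.
- move=> i j k p q r x /add_cellP[y1|[? ?]] /add_cellP[y2|[? ?]]; try exact: hC x y1 y2.
  + by have := min_ab x; lia.
  + by have := none _ _ y2; lia.
  + by lia.
- move=> i j k p q r x /add_cellP[y1|[? ?]] /add_cellP[y2|[? ?]]; try exact: hD x y1 y2.
  + by have := min_ab x; lia.
  + by have := min_ab x; have := hy y2; lia.
  + by lia.
- move=> i j k p q r /add_cellP[y0|[? ?]] /add_cellP[y1|[? ?]] /add_cellP[y2|[? ?]];
    try exact: hE y0 y1 y2.
  + by have := none _ _ y1; lia.
  + by have := none _ _ y0; lia.
  + by lia.
  + by have := hy y2; lia.
  + by lia.
  + by lia.
  + by lia.
Qed.

(** The y-cells assigned to the lower path: those below row a, and those with another y-cell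
    strictly above and strictly to the right. *)
Let Q i j := py i j && ((a < i) || (j < colmax py i)).

(** Two cells of [Q] in the wrong position form, with [xab] or with a y-cell above and to the right,
    a monomial of type D or E. *)
Lemma Q_chain i j i' j' : Q i j -> Q i' j' -> i' < i -> j' <= j.
Proof.
move=> /andP[y _] /andP[y' h'] lt; rewrite leqNgt; apply/negP => ltj.
case/orP: h' => h'.
  have := y_outside y' => h; apply: (hD xab y' y); lia.
by have [i2 [j2 [l1 l2 y2]]] := ltn_colmax h'; apply: (hE y2 y' y).
Qed.

Lemma Q_leq_b i j : Q i j -> j <= b.
Proof.
move=> /andP[y h]; case: (leqP i a) h => ia /= h; last by have := y_outside y; lia.
rewrite leqNgt; apply/negP => lt.
by have [i2 [j2 [l1 l2 y2]]] := ltn_colmax h; apply: (hC xab y y2).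
Qed.

(** The paths are the running column maxima of all y-cells, of [Q] and of the x-cells. A y-cell
    outside [Q] has no y-cell above it further right and lies on the upper path; the other two sets
    are chains. The maximum with b corrects the default 0 of [colmax] above the first x-cell. *)
Lemma maximal_standard_path : exists d, [/\ valid m n d,
  forall i j, py i j -> ycells m d i j & forall i j, px i j -> xcells m d i j].
Proof.
have [la lb] := hx xab.
have e0 : colmax py 0 = 0 by apply/eqP; rewrite -leqn0; apply: colmax_leq.
have Q0 j : Q 0 j = false by rewrite /Q e0 ltn0 /= andbF.
exists (PathData a b (colmax py) (colmax Q) (fun i => maxn b (colmax px i))); split.
- split=> //=.
  + apply/eqP; rewrite eqn_leq; apply/andP; split.
      by apply: colmax_leq => i j _ y; have := hy y; lia.
    by apply: (leq_colmax _ _ max_y_right); lia.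
  + by move=> i _; apply: colmax_mono.
  + apply/eqP; rewrite -leqn0; apply: colmax_leq => i j; rewrite ltnS leqn0 => /eqP->.
    by rewrite Q0.
  + apply/eqP; rewrite eqn_leq; apply/andP; split.
      by apply: colmax_leq => i j _; apply: Q_leq_b.
    apply: (@leq_colmax _ _ m.-1); [by lia | by [] |].
    rewrite /Q max_y_bottom /=; case: (ltnP a m.-1) => //= am.
    have [|i [j [im bj y]]] := max_y_above; first by lia.
    by apply: leq_trans bj _; apply: (leq_colmax _ _ y) => //; have := hy y; lia.
  + by move=> i _; apply: colmax_mono.
  + apply/maxn_idPl; apply: colmax_leq => i j ia x.
    by have := min_ab x; lia.
  + apply/eqP; rewrite eqn_leq geq_max leq_max; apply/andP; split.
      apply/andP; split; first by lia.
      by apply: colmax_leq => i j _ x; have := hx x; lia.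
    by apply/orP; right; apply: (leq_colmax _ _ max_x_corner); lia.
  + by move=> i _; rewrite geq_max !leq_max leqnn /= colmax_mono orbT.
  + move=> i /andP[i0 ia].
    have [j0 [j00 y0]] := max_y_first.
    (* If [Q] has no cell in rows up to i, the left side is the default 0, so the right side must be
       positive. A cell of [Q] in these rows has a y-cell strictly above and to the right, which
       gives the strict bound. *)
    have e_pos : 0 < colmax py i.
      by apply: leq_trans j00 _; apply: (leq_colmax _ _ y0) => //; have := hy y0; lia.
    rewrite -(prednK e_pos) ltnS; apply: colmax_leq => i' j' li /andP[y' h].
    have {}h : j' < colmax py i' by case/orP: h; lia.
    have [i2 [j2 [l1 l2 y2]]] := ltn_colmax h.
    suff : j2 <= colmax py i by lia.
    by apply: (leq_colmax _ _ y2); [lia | have := hy y2; lia].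
- move=> i j y; have [im jn] := hy y.
  have [Qij|nQ] := boolP (Q i j); apply/orP; [right|left]; apply/and4P; split=> //=.
  + by case: (posnP i) Qij => // ->; rewrite Q0.
  + by lia.
  + by apply: colmax_leq => i' j' li Q'; apply: Q_chain Qij Q' li.
  + exact: (leq_colmax _ _ Qij).
  + by move: nQ; rewrite /Q y /= negb_or; lia.
  + by move: nQ; rewrite /Q y /= negb_or; lia.
  + exact: (leq_colmax _ _ y).
move=> i j x; have [im jn] := hx x; have [ai bj] := min_ab x.
apply/and4P; split=> //=; first by lia.
  rewrite geq_max bj; apply: colmax_leq => i' j' li x'; rewrite leqNgt; apply/negP => lt.
  exact: hA x' x li lt.
by rewrite leq_max; apply/orP; right; apply: (leq_colmax _ _ x).
Qed.
End Min.
End Extension.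

(** * The greedy algorithm on a triple of paths *)

Section Transport.
Variables m n : nat.
Implicit Types Z : 'I_m -> 'I_n -> nat.

Lemma sum_leq_at (T : finType) (f g : T -> nat) x : \sum_t f t <= \sum_t g t ->
  (forall t, t != x -> f t = g t \/ g t = 0) -> f x <= g x.
Proof.
rewrite (bigD1 x) //= [X in _ <= X](bigD1 x) //= => le fg.
have : \sum_(t | t != x) g t <= \sum_(t | t != x) f t.
  by apply: leq_sum => t /fg[->|->].
by lia.
Qed.

Definition later (i i' : 'I_m) (j j' : 'I_n) : bool := (i < i') || (i == i') && (j < j').

(* Every cell [(i, j)] is preceded by no cell of the path in its row, or in its
   column, or at all, so that one of the three bounds applies. *)
Lemma transport h r0 r1 (Z Z0 : 'I_m -> 'I_n -> nat) :
  r1 < m -> (forall i, r0 <= i <= r1 -> h i <= h i.+1) ->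
  (forall i j, Z0 i j != 0 -> in_path r0 r1 h i j) ->
  (forall i : 'I_m, r0 < i -> \sum_j Z i j <= \sum_j Z0 i j) ->
  (forall j : 'I_n, h r0 < j -> \sum_i Z i j <= \sum_i Z0 i j) ->
  \sum_i \sum_j Z i j <= \sum_i \sum_j Z0 i j ->
  forall i j, (forall i' j', later i i' j j' -> Z i' j' = Z0 i' j') -> Z i j <= Z0 i j.
Proof.
move=> lt hm supp rows cols tot i j eqZ.
have mono k l : r0 <= k -> k <= l -> l <= r1.+1 -> h k <= h l.
  by apply: mono_leq => e ?; apply: hm; lia.
have zero (i' : 'I_m) (j' : 'I_n) : ~~ in_path r0 r1 h i' j' -> Z0 i' j' = 0.
  by move=> np; apply/eqP; apply: contraNT np; apply: supp.
have by_row : r0 < i -> (forall j' : 'I_n, j' < j -> ~~ in_path r0 r1 h i j') -> Z i j <= Z0 i j.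
  move=> ri np; apply: (sum_leq_at (rows i ri)) => j' ne.
  case: (ltngtP j' j) => [lj|lj|/val_inj E]; last by rewrite E eqxx in ne.
    by right; apply/zero/np.
  by left; apply: eqZ; rewrite /later eqxx lj orbT.
have by_col : h r0 < j -> (forall i' : 'I_m, i' < i -> ~~ in_path r0 r1 h i' j) -> Z i j <= Z0 i j.
  move=> cj np; apply: (sum_leq_at (f := Z^~ j) (g := Z0^~ j) (cols j cj)) => i' ne.
  case: (ltngtP i' i) => [li|li|/val_inj E]; last by rewrite E eqxx in ne.
    by right; apply/zero/np.
  by left; apply: eqZ; rewrite /later li.
have by_tot : (forall (i' : 'I_m) (j' : 'I_n), later i' i j' j -> ~~ in_path r0 r1 h i' j') ->
    Z i j <= Z0 i j.
  move=> np; move: tot; rewrite !pair_bigA /=.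
  move/(@sum_leq_at _ (fun p => Z p.1 p.2) (fun p => Z0 p.1 p.2) (i, j)); apply=> -[i' j'] ne /=.
  case: (ltngtP i' i) => [li|li|/val_inj E].
  - by right; apply/zero/np; rewrite /later li.
  - by left; apply: eqZ; rewrite /later li.
  subst i'; case: (ltngtP j' j) => [lj|lj|/val_inj E]; last by rewrite E eqxx in ne.
    by right; apply/zero/np; rewrite /later eqxx lj orbT.
  by left; apply: eqZ; rewrite /later eqxx lj orbT.
have [ri|ri] := ltnP r0 i; last first.
  have [cj|cj] := ltnP (h r0) j.
    apply: by_col => // i' li; rewrite /in_path; lia.
  apply: by_tot => i' j' /orP[li|/andP[/eqP-> lj]]; rewrite /in_path; first by lia.
  by have [E|ne] := eqVneq (i : nat) r0; [rewrite E|]; lia.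
have [ir|ir] := leqP i r1; last by apply: by_row => // j' _; rewrite /in_path; lia.
have [ji|ji] := leqP j (h i); first by apply: by_row => // j' lj; rewrite /in_path; lia.
apply: by_col; first by have := mono r0 i; lia.
move=> i' li; rewrite /in_path; apply/negP => /and4P[ri' ir' _].
by have := mono i'.+1 i; lia.
Qed.

Variable d : path_data.
Hypothesis vd : valid m n d.

(** [X] holds the exponents of the x_ij; [Y1] and [Y2] count the choices of u_i w_j and z_i v_j.
    Equal margins mean that both triples give the same monomial in u, v, w, z. *)
Variables X Y1 Y2 X0 Y10 Y20 : 'I_m -> 'I_n -> nat.
Hypothesis suppX : forall i j, X0 i j != 0 -> xcells m d i j.
Hypothesis supp1 : forall i j, Y10 i j != 0 -> upper d i j.
Hypothesis supp2 : forall i j, Y20 i j != 0 -> lower m d i j.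
Hypothesis marginU : forall i, \sum_j X i j + \sum_j Y1 i j = \sum_j X0 i j + \sum_j Y10 i j.
Hypothesis marginV : forall j, \sum_i X i j + \sum_i Y2 i j = \sum_i X0 i j + \sum_i Y20 i j.
Hypothesis marginW : forall j, \sum_i Y1 i j = \sum_i Y10 i j.
Hypothesis marginZ : forall i, \sum_j Y2 i j = \sum_j Y20 i j.

Lemma total1 : \sum_i \sum_j Y1 i j = \sum_i \sum_j Y10 i j.
Proof. by rewrite exchange_big [RHS]exchange_big; apply: eq_bigr => j _. Qed.

Lemma total2 : \sum_i \sum_j Y2 i j = \sum_i \sum_j Y20 i j.
Proof. by apply: eq_bigr => i _. Qed.

Lemma totalX : \sum_i \sum_j X i j = \sum_i \sum_j X0 i j.
Proof.
have := total1; have : \sum_i (\sum_j X i j + \sum_j Y1 i j) =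
  \sum_i (\sum_j X0 i j + \sum_j Y10 i j) by apply: eq_bigr => i _.
by rewrite !big_split /=; lia.
Qed.

(** The upper path stays in rows up to [pa d] and the lower one in columns up to [pb d]; beyond
    these, the margins of u and v bound the sums of [X] alone. *)
Lemma transportX i j : (forall i' j', later i i' j j' -> X i' j' = X0 i' j') -> X i j <= X0 i j.
Proof.
have am := lt_pa vd.
apply: (@transport (pg d) (pa d) m.-1) => //; first by lia.
- by move=> k hk; apply: (pg_mono vd); lia.
- move=> k ak; have := marginU k; rewrite [X in _ = _ + X]big1 => [|l _]; first by lia.
  by apply/eqP; apply: contraTT ak => /supp1; rewrite /upper /in_path; lia.
- move=> l; rewrite (pg_start vd) => bl; have := marginV l.
  rewrite [X in _ = _ + X]big1 => [|k _]; first by lia.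
  apply/eqP; apply: contraTT bl => /supp2; rewrite /lower /in_path.
  by have := @pf_bound _ _ _ vd k.+1; have := ltn_ord k; lia.
by rewrite totalX.
Qed.

Hypothesis eqX : forall i j, X i j = X0 i j.

Lemma transport1 i j : (forall i' j', later i i' j j' -> Y1 i' j' = Y10 i' j') -> Y1 i j <= Y10 i j.
Proof.
have am := lt_pa vd.
apply: (@transport (pe d) 0 (pa d)) => //.
- by move=> k hk; apply: (pe_mono vd); lia.
- move=> k _; have := marginU k.
  have -> : \sum_l X k l = \sum_l X0 k l by apply: eq_bigr => l _; apply: eqX.
  by lia.
- by move=> l _; rewrite marginW.
by rewrite total1.
Qed.

Lemma transport2 i j : (forall i' j', later i i' j j' -> Y2 i' j' = Y20 i' j') -> Y2 i j <= Y20 i j.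
Proof.
have am := lt_pa vd.
apply: (@transport (pf d) 1 m.-1) => //; first by lia.
- by move=> k hk; apply: (pf_mono vd); lia.
- by move=> k _; rewrite marginZ.
- move=> l _; have := marginV l.
  have -> : \sum_k X k l = \sum_k X0 k l by apply: eq_bigr => k _; apply: eqX.
  by lia.
by rewrite total2.
Qed.

(** Proceeding from the last cell backwards, both [Y1] and [Y2] are bounded by [Y10] and [Y20], and
    equal sums turn the two inequalities into equalities. *)
Lemma transport_later i j :
  (forall i' j', later i i' j j' -> Y1 i' j' + Y2 i' j' = Y10 i' j' + Y20 i' j') ->
  forall i' j', later i i' j j' -> Y1 i' j' = Y10 i' j' /\ Y2 i' j' = Y20 i' j'.
Proof.
move=> eqN i' j'.
have [k] := ubnP (m * n - (i' * n + j')); elim: k => // k IH in i' j' *.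
move=> lk lt.
have step i2 j2 : later i' i2 j' j2 -> Y1 i2 j2 = Y10 i2 j2 /\ Y2 i2 j2 = Y20 i2 j2.
  move=> lt2; have lt2' : i' * n + j' < i2 * n + j2.
    by move: lt2; rewrite -!val_yi => /orP[/lt_yi_row->//|/andP[/eqP-> /lt_yi_col->]].
  apply: IH; first by have := ltn_ord (mxvec_index i2 j2); rewrite val_mxvec_index; lia.
  by move: lt lt2; rewrite /later -!val_eqE /=; lia.
have le1 := @transport1 i' j' (fun i2 j2 h => (step i2 j2 h).1).
have le2 := @transport2 i' j' (fun i2 j2 h => (step i2 j2 h).2).
by have := eqN i' j' lt; lia.
Qed.

End Transport.

(** * Digits in base [B] and polynomials in one variable *)

Section Digits.
Variable B : nat.

(** The remainders [R] and [R'] allow successive blocks of digits to be peeled off. *)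
Lemma digits_inj k (r r' : 'I_k -> nat) R R' :
  (forall i, r i < B) -> (forall i, r' i < B) ->
  \sum_i r i * B ^ i + B ^ k * R = \sum_i r' i * B ^ i + B ^ k * R' ->
  r =1 r' /\ R = R'.
Proof.
elim: k => [|k IH] in r r' R R' *.
  by move=> _ _; rewrite !big_ord0 !add0n !expn0 !mul1n => ->; split=> // -[].
move=> rB r'B; rewrite !big_ord_recl /= !expn0 !muln1.
have B0 : 0 < B by apply: leq_ltn_trans (rB ord0).
have shift (f : 'I_k.+1 -> nat) S : \sum_(i < k) f (lift ord0 i) * B ^ bump 0 i + B ^ k.+1 * S =
    (\sum_(i < k) f (lift ord0 i) * B ^ i + B ^ k * S) * B.
  rewrite mulnDl big_distrl /= expnS [B * _]mulnC -[_ * B * S]mulnA [B * S]mulnC mulnA.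
  by congr (_ + _); apply: eq_bigr => i _; rewrite -mulnA -expnSr.
rewrite -!addnA !shift => E.
have E0 : r ord0 = r' ord0.
  have := congr1 (fun x => x %% B) E.
  by rewrite /= ![_ + _ * B]addnC !modnMDl !modn_small.
have {E}E : (\sum_(i < k) r (lift ord0 i) * B ^ i + B ^ k * R) =
            (\sum_(i < k) r' (lift ord0 i) * B ^ i + B ^ k * R').
  by apply/eqP; rewrite -(eqn_pmul2r B0); apply/eqP; lia.
have [rr' RR'] := IH _ _ _ _ (fun i => rB _) (fun i => r'B _) E.
by split=> // i; case: (unliftP ord0 i) => [i' ->|->].
Qed.
End Digits.

Local Open Scope ring_scope.

(** If P is nonzero, P X + 1 is not constant and has a root t. Then t is nonzero, so P vanishes at t
    and 1 = 0. *)
Lemma closed_field_poly_eq0 (K : closedFieldType) (P : {poly K}) :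
  (forall t, t != 0 -> P.[t] = 0) -> P = 0.
Proof.
move=> Pz; apply/eqP/negPn/negP => P0.
have sQ : size (P * 'X + 1%:P) != 1%N.
  rewrite size_polyDl size_mulX // ?size_poly1 ?ltnS ?size_poly_gt0 //.
  by rewrite -lt0n size_poly_gt0.
have /closed_rootP[t] := sQ; rewrite /root !hornerE => /eqP E.
have [t0|nt0] := eqVneq t 0.
  by move: E; rewrite t0 mulr0 add0r => /eqP; rewrite oner_eq0.
by move: E; rewrite Pz // mul0r add0r => /eqP; rewrite oner_eq0.
Qed.

Lemma expr_binom_exp (R : comNzRingType) (s s' k D : nat) : (k <= D)%N ->
  ('X^s + 'X^s' : {poly R}) ^+ k =
  \sum_(c < D.+1) 'C(k, c)%:R *: 'X^(s * (k - c) + s' * c).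
Proof.
move=> kD; rewrite exprDn.
rewrite (big_ord_widen D.+1 (fun c => ('X^s ^+ (k - c) * 'X^s' ^+ c) *+ 'C(k, c))) //.
rewrite big_mkcond; apply: eq_bigr => c _; rewrite ltnS.
case: leqP => [_|lt]; last by rewrite bin_small // scale0r.
by rewrite -!exprM -exprD scaler_nat.
Qed.

(** A uniform bound [D] makes the choices range over one finite type; excessive choices have
    binomial coefficient 0. *)
Lemma prod_binom_exp (R : comNzRingType) (I : finType) (s s' k : I -> nat) (D : nat) :
  (forall i, k i <= D)%N ->
  \prod_i ('X^(s i) + 'X^(s' i) : {poly R}) ^+ k i =
  \sum_(c : {ffun I -> 'I_D.+1})
    (\prod_i 'C(k i, c i))%N%:R *: 'X^(\sum_i (s i * (k i - c i) + s' i * c i))%N.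
Proof.
move=> kD; rewrite (eq_bigr _ (fun i _ => expr_binom_exp _ _ _ (kD i))) bigA_distr_bigA.
apply: eq_bigr => c _; rewrite scaler_prod natr_prod; congr (_ *: _).
by rewrite -(big_morph _ (exprD 'X) (expr0 'X)).
Qed.

(** * Parametrization of the principal component *)

Lemma det_mx22 (R : comNzRingType) (A : 'M[R]_2) : \det A = A 0 0 * A 1 1 - A 0 1 * A 1 0.
Proof.
have l01 : lift ord0 ord0 = 1 :> 'I_2 by apply/val_inj.
have l10 : lift 1 ord0 = 0 :> 'I_2 by apply/val_inj.
rewrite (expand_det_row A 0) big_ord_recl big_ord1 /cofactor !det_mx11 !mxE l01.
by rewrite ?l01 ?l10 /= expr0 expr1 mul1r mulN1r mulrN.
Qed.

Lemma coef_lin_minor (R : comNzRingType) (a b c d a' b' c' d' : R) k : (k < 2)%N ->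
  ((a%:P + b%:P * 'X) * (c%:P + d%:P * 'X) - (a'%:P + b'%:P * 'X) * (c'%:P + d'%:P * 'X))`_k =
  if k == 0%N then a * c - a' * c' else a * d + b * c - (a' * d' + b' * c').
Proof.
case: k => [|[|//]] _; rewrite coefB ?coef0M ?coefM.
  by rewrite !coefD !coefMX !coefC !addr0.
by rewrite !big_ord_recl !big_ord0 !coefD !coefMX !coefC /= !addr0 !add0r.
Qed.

Section Param.
Variables (K : fieldType) (m n : nat).
Local Notation N := (m * n + m * n)%N.

Definition tangent_point (u z : 'I_m -> K) (v w : 'I_n -> K) : 'rV[K]_N :=
  jet_point (\matrix_(i, j) (u i * v j)) (\matrix_(i, j) (u i * w j + z i * v j)).

Lemma meval_sum (v : 'I_N -> K) (I : Type) (r : seq I) (P : pred I) (F : I -> {mpoly K[N]}) :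
  (\sum_(i <- r | P i) F i).@[v] = \sum_(i <- r | P i) (F i).@[v].
Proof. exact: raddf_sum. Qed.

Lemma jet_point_y (A B : 'M[K]_(m, n)) i j : jet_point A B 0 (yi i j) = B i j.
Proof. by rewrite /jet_point /yi row_mxEl mxvecE. Qed.

Lemma jet_point_x (A B : 'M[K]_(m, n)) i j : jet_point A B 0 (xi i j) = A i j.
Proof. by rewrite /jet_point /xi row_mxEr mxvecE. Qed.

Lemma tangent_point_y u z v w i j : tangent_point u z v w 0 (yi i j) = u i * w j + z i * v j.
Proof. by rewrite jet_point_y mxE. Qed.

Lemma tangent_point_x u z v w i j : tangent_point u z v w 0 (xi i j) = u i * v j.
Proof. by rewrite jet_point_x mxE. Qed.

Definition minor0 (A : 'M[K]_(m, n)) i1 i2 j1 j2 : K :=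
  A i1 j1 * A i2 j2 - A i1 j2 * A i2 j1.
Definition minor1 (A B : 'M[K]_(m, n)) i1 i2 j1 j2 : K :=
  A i1 j1 * B i2 j2 + B i1 j1 * A i2 j2 - (A i1 j2 * B i2 j1 + B i1 j2 * A i2 j1).

Lemma jet_minor_coefE (f : 'I_2 -> 'I_m) (g : 'I_2 -> 'I_n) (A B : 'M[K]_(m, n)) c : (c < 2)%N ->
  ((\det (mxsub f g (generic_jet_matrix K m n)))`_c).@[jet_point A B 0] =
  if c == 0%N then minor0 A (f 0) (f 1) (g 0) (g 1)
  else minor1 A B (f 0) (f 1) (g 0) (g 1).
Proof.
have vx i j : (xvar K i j).@[jet_point A B 0] = A i j by rewrite mevalXU jet_point_x.
have vy i j : (yvar K i j).@[jet_point A B 0] = B i j by rewrite mevalXU jet_point_y.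
rewrite det_mx22 !mxE; move: (xvar K) (yvar K) vx vy => X Y vx vy.
move=> c2; rewrite coef_lin_minor //.
by case: ifP => _; rewrite mevalB ?mevalD !mevalM !vx ?vy.
Qed.

Lemma jet_point_zeros (A B : 'M[K]_(m, n)) :
  (forall i1 i2 j1 j2, minor0 A i1 i2 j1 j2 = 0 /\ minor1 A B i1 i2 j1 j2 = 0) ->
  zeros (@jet_ideal K m n) (jet_point A B).
Proof.
move=> AB p [s [sS ->]]; rewrite meval_sum big_seq big1 // => c /sS[f [g [k [_ _ k2 ->]]]].
rewrite mevalM jet_minor_coefE //.
have [-> ->] := AB (f 0) (f 1) (g 0) (g 1).
by case: ifP => _; rewrite mulr0.
Qed.

(** The ideal is generated by minors with increasing indices; antisymmetry covers the others. *)
Lemma jet_zeros_minor (A B : 'M[K]_(m, n)) : zeros (@jet_ideal K m n) (jet_point A B) ->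
  forall i1 i2 j1 j2, minor1 A B i1 i2 j1 j2 = 0.
Proof.
move=> zAB.
have ltP (i1 i2 : 'I_m) (j1 j2 : 'I_n) : (i1 < i2)%N -> (j1 < j2)%N -> minor1 A B i1 i2 j1 j2 = 0.
  move=> lti ltj; pose f (a : 'I_2) := if a == 0 then i1 else i2.
  pose g (a : 'I_2) := if a == 0 then j1 else j2.
  pose q := (\det (mxsub f g (generic_jet_matrix K m n)))`_1.
  have Jq : jet_ideal q.
    exists [:: (1, q)]; split; last by rewrite big_seq1 mul1r.
    move=> c; rewrite inE => /eqP-> /=; exists f, g, 1%N; split=> //.
      by move=> [[|[|//]] ?] [[|[|//]] ?].
    by move=> [[|[|//]] ?] [[|[|//]] ?].
  by have := zAB q Jq; rewrite /q jet_minor_coefE.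
have ltP' (i1 i2 : 'I_m) (j1 j2 : 'I_n) : (i1 < i2)%N -> minor1 A B i1 i2 j1 j2 = 0.
  move=> lti; case: (ltngtP j1 j2) => [|ltj|/val_inj->]; first exact: ltP.
    by have := ltP _ _ _ _ lti ltj; rewrite /minor1 => E; rewrite -[RHS]oppr0 -E; ring.
  by rewrite /minor1; ring.
move=> i1 i2 j1 j2; case: (ltngtP i1 i2) => [|lti|/val_inj->]; first exact: ltP'.
  by have := ltP' _ _ j1 j2 lti; rewrite /minor1 => E; rewrite -[RHS]oppr0 -E; ring.
by rewrite /minor1; ring.
Qed.

Lemma tangent_point_component u z v w i j : u i != 0 -> v j != 0 ->
  principal_component (tangent_point u z v w).
Proof.
move=> ui vj Z' _; apply; rewrite /tangent_point.
set A := (X in jet_point X _); set B := (X in jet_point _ X).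
exists A, B; split=> //.
  apply: jet_point_zeros => i1 i2 j1 j2; rewrite /minor0 /minor1 !mxE; split; ring.
have AE : A = (\col_k u k) *m (\row_k v k).
  by apply/matrixP => k l; rewrite !mxE big_ord1 !mxE.
apply/eqP; rewrite eqn_leq; apply/andP; split.
  by rewrite AE; apply: leq_trans (mulmx_max_rank _ _) _.
rewrite lt0n mxrank_eq0; apply/eqP => /matrixP/(_ i j); rewrite !mxE.
by move/eqP; rewrite mulf_eq0 (negbTE ui) (negbTE vj).
Qed.

Lemma principal_component_tangent (A B : 'M[K]_(m, n)) :
  zeros (@jet_ideal K m n) (jet_point A B) -> \rank A = 1%N ->
  exists u z v w, jet_point A B = tangent_point u z v w.
Proof.
move=> /jet_zeros_minor zAB rA.
have [u [v Auv]] : exists (u : 'I_m -> K) (v : 'I_n -> K), forall i j, A i j = u i * v j.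
  have := mulmx_base A; move: (col_base A) (row_base A); rewrite rA => c r <-.
  by exists (fun i => c i 0), (r 0) => i j; rewrite mxE big_ord1.
have [i0 [j0 Aij]] : exists i j, A i j != 0.
  apply: NNPP => ne; have : A = 0.
    apply/matrixP => i j; rewrite mxE; apply/eqP/negPn/negP => nz.
    by apply: ne; exists i, j.
  by move=> A0; rewrite A0 mxrank0 in rA.
move: (Aij); rewrite Auv mulf_eq0 negb_or => /andP[ui vj].
(* Normalized by w_(j0) = 0: column j0 of B gives z and row i0 gives w. The minors through (i0, j0)
   then determine all other entries. *)
exists u, (fun i => B i j0 / v j0), v, (fun j => (B i0 j - B i0 j0 / v j0 * v j) / u i0).
rewrite /tangent_point; congr jet_point; apply/matrixP => i j; rewrite mxE ?Auv //.
have := zAB i0 i j0 j; rewrite /minor1 !Auv => E.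
apply: (mulfI Aij); rewrite Auv; apply/eqP; rewrite -subr_eq0 -E; apply/eqP.
by field; rewrite ui vj.
Qed.

(** The zero set of [p] is closed and contains all points with A of rank 1, hence their closure. *)
Lemma principal_idealP (p : {mpoly K[N]}) :
  (forall u z v w, p.@[tangent_point u z v w 0] = 0) -> principal_ideal p.
Proof.
move=> pz z Yz; apply: (Yz (fun z => p.@[z 0] = 0)).
  exists (fun q => q = p) => y; split; first by move=> py q ->.
  by move=> /(_ p erefl).
move=> _ [A [B [-> zAB rA]]].
by have [u [z' [v [w ->]]]] := principal_component_tangent zAB rA.
Qed.
End Param.

(** * Leading monomials of minors *)

Section Leading.
Variables (K : fieldType) (N : nat).
Implicit Types (s t : seq 'I_N) (a b : 'X_{1..N}).

Definition mon s : 'X_{1..N} := (\sum_(v <- s) U_(v))%MM.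

Lemma monE s v : mon s v = count_mem v s.
Proof.
rewrite mnm_sumE -sum1_count [RHS]big_mkcond.
by apply: eq_bigr => w _; rewrite mnm1E /=; case: eqP.
Qed.

Lemma mdeg_mon s : mdeg (mon s) = size s.
Proof. by rewrite mdeg_sum -sum1_size; apply: eq_bigr => w _; rewrite mdeg1. Qed.

Lemma mpolyX_mon s : 'X_[mon s] = \prod_(v <- s) 'X_v :> {mpoly K[N]}.
Proof.
by rewrite /mon; elim: s => [|v s IH]; rewrite ?big_nil ?mpolyX0 ?big_cons ?mpolyXD ?IH.
Qed.

Lemma grevlex_irr a : ~ grevlex_lt a a.
Proof. by case=> [|[_ [i []]]]; rewrite ltnn. Qed.

(** The smallest variable involved is [w], and it occurs in [s] only. *)
Lemma grevlex_mon_last s t (w : 'I_N) : size s = size t -> w \in s ->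
  all (fun v : 'I_N => v <= w)%N s -> all (fun v : 'I_N => v < w)%N t ->
  grevlex_lt (mon s) (mon t).
Proof.
move=> est ws /allP sw /allP tw; right; split; first by rewrite !mdeg_mon.
exists w; rewrite !monE; split.
  have /count_memPn-> : w \notin t by apply/negP => /tw; rewrite ltnn.
  by rewrite -has_count has_pred1.
move=> j wj; rewrite !monE.
have /count_memPn-> : j \notin s by apply/negP => /sw; rewrite leqNgt wj.
by have /count_memPn-> : j \notin t by apply/negP => /tw; rewrite ltnNge ltnW.
Qed.

Lemma grevlex_mon_cons (x : 'I_N) s t : grevlex_lt (mon s) (mon t) ->
  grevlex_lt (mon (x :: s)) (mon (x :: t)).
Proof.
rewrite /grevlex_lt !mdeg_mon /= => -[lt|[-> [i [lt eq]]]]; [by left | right; split=> //].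
exists i; move: lt; rewrite !monE /= ltn_add2l => lt; split=> // j /eq.
by rewrite !monE /= => ->.
Qed.

Definition mon_poly (t : seq 'I_N) (l : seq (K * seq 'I_N)) : {mpoly K[N]} :=
  'X_[mon t] + \sum_(c <- l) c.1 *: 'X_[mon c.2].

Lemma meval_mon_poly t l (z : 'I_N -> K) : (mon_poly t l).@[z] =
  \prod_(v <- t) z v + \sum_(c <- l) c.1 * \prod_(v <- c.2) z v.
Proof.
have ev s : ('X_[mon s] : {mpoly K[N]}).@[z] = \prod_(v <- s) z v.
  rewrite mpolyX_mon; elim: s => [|v s IH]; first by rewrite !big_nil meval1.
  by rewrite !big_cons mevalM mevalXU IH.
rewrite mevalD ev; congr (_ + _); rewrite raddf_sum /=.
by apply: eq_bigr => c _; rewrite mevalZ ev.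
Qed.

Lemma leading_mon_poly t l : {in l, forall c, grevlex_lt (mon c.2) (mon t)} ->
  leading_monomial (mon_poly t l) (mon t).
Proof.
move=> lt.
have coefE b : (mon_poly t l)@_b = (mon t == b)%:R + \sum_(c <- l) c.1 * (mon c.2 == b)%:R.
  rewrite mcoeffD mcoeffX; congr (_ + _); rewrite raddf_sum /=.
  by apply: eq_bigr => c _; rewrite mcoeffZ mcoeffX.
split.
  rewrite mcoeff_msupp coefE eqxx big_seq big1 ?addr0 ?oner_neq0 // => c cl.
  case: eqP => [E|]; last by rewrite mulr0.
  by case: (@grevlex_irr (mon t)); rewrite -{1}E; apply: lt.
move=> b; rewrite mcoeff_msupp coefE.
have [->|nb] := eqVneq (mon t) b; first by left.
move=> nz; right; apply: NNPP => nlt; move: nz.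
rewrite add0r big_seq big1 ?eqxx // => c cl; case: eqP => [E|]; last by rewrite mulr0.
by case: nlt; rewrite -E; apply: lt.
Qed.

(** As [s] has no repetition, its monomial is squarefree and divides the product over [F]. *)
Lemma leading_mon_ideal (S : {mpoly K[N]} -> Prop) p s (F : {set 'I_N}) :
  S p -> leading_monomial p (mon s) -> uniq s -> {subset s <= F} ->
  ~ stanley_reisner_face (leading_ideal S) F.
Proof.
move=> Sp lp us sF nF; apply: nF.
have pa : p@_(mon s) != 0 by rewrite -mcoeff_msupp; case: lp.
exists [:: ((p@_(mon s))^-1 *: \prod_(v in F | v \notin s) 'X_v, p@_(mon s) *: 'X_[mon s])].
split.
  move=> c; rewrite inE => /eqP-> /=.
  exists [:: (1, p@_(mon s) *: 'X_[mon s])]; split; last by rewrite big_seq1 mul1r.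
  by move=> c'; rewrite inE => /eqP-> /=; exists p; split=> //; exists (mon s).
rewrite big_seq1 /= -scalerAl -scalerAr scalerA mulVf // scale1r mpolyX_mon.
rewrite (bigID (mem s)) /= mulrC; congr (_ * _).
rewrite big_uniq //; apply: eq_bigl => v /=.
by case: (boolP (v \in s)) => [/sF->//|_]; rewrite andbF.
Qed.
End Leading.

(** * Faces avoid the generators of types A to E *)

Section FaceStandard.
Variables (K : fieldType) (m n : nat).
Local Notation N := (m * n + m * n)%N.

(* Each generator is the leading monomial of a minor of size 2 or 3 (or of its
   derivative), expanded as a list of signed monomials. *)
Variable F : {set 'I_N}.
Hypothesis faceF : jet_complex K m n F.

Lemma not_face (t : seq 'I_N) (l : seq (K * seq 'I_N)) :
  (forall u z v w, (mon_poly t l).@[tangent_point u z v w 0] = 0) ->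
  {in l, forall c, grevlex_lt (mon c.2) (mon t)} -> uniq t -> {subset t <= F} -> False.
Proof.
move=> z0 lt ut tF; apply: (@leading_mon_ideal _ _ _ (mon_poly t l) t F _ _ ut tF faceF).
  exact: principal_idealP.
exact: leading_mon_poly.
Qed.

Ltac eval_tangent :=
  move=> u z v w; rewrite meval_mon_poly !(big_cons, big_nil) /=;
  rewrite !(tangent_point_x, tangent_point_y); ring.
Ltac cell_lt :=
  rewrite ?leqnn //;
  first [done | exact: lt_yi_xi | exact: lt_xi_row | exact: lt_yi_row
    | exact: lt_xi_col | exact: lt_yi_col
    | apply: ltnW; first [exact: lt_yi_xi | exact: lt_xi_row | exact: lt_yi_row
                         | exact: lt_xi_col | exact: lt_yi_col]
    | apply: lt_xi_row; lia | apply: lt_yi_row; lia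
    | apply: ltnW; first [apply: lt_xi_row; lia | apply: lt_yi_row; lia]].
Ltac last_cell w :=
  apply: (@grevlex_mon_last _ _ _ w);
  rewrite /= ?inE ?eqxx ?orbT // ?andbT; repeat (apply/andP; split); cell_lt.
Ltac each_term := move=> c; rewrite !inE; do ?[case/orP]; move/eqP=> ->; rewrite /=.
Ltac uniq_cells := rewrite /= !inE ?eq_xi ?eq_yi ?eq_xi_yi -?val_eqE /=; lia.
Ltac sub_cells := move=> c; rewrite !inE; do ?[case/orP]; move/eqP=> -> //.

Lemma face_A (i j : 'I_m) (k l : 'I_n) :
  xi i l \in F -> xi j k \in F -> (i < j)%N -> (k < l)%N -> False.
Proof.
move=> x1 x2 ij kl.
apply: (@not_face [:: xi i l; xi j k] [:: (-1, [:: xi j l; xi i k])]).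
- eval_tangent.
- by each_term; last_cell (xi j l).
- uniq_cells.
- sub_cells.
Qed.

Lemma face_B (i j : 'I_m) (k l : 'I_n) :
  xi i k \in F -> yi j l \in F -> (i < j)%N -> (k < l)%N -> False.
Proof.
move=> x1 y2 ij kl.
apply: (@not_face [:: xi i k; yi j l]
  [:: (1, [:: xi j l; yi i k]); (-1, [:: xi j k; yi i l]); (-1, [:: xi i l; yi j k])]).
- eval_tangent.
- each_term; [last_cell (xi j l) | last_cell (xi j k) | last_cell (xi i l)].
- uniq_cells.
- sub_cells.
Qed.

(** Row k of A and rows j, i of B lie in the span of v and w, so their 3-minor on columns p, q, r
    vanishes. *)
Lemma face_C (i j k : 'I_m) (p q r : 'I_n) :
  xi k p \in F -> yi j q \in F -> yi i r \in F -> (i < j)%N -> (p < q)%N -> (q < r)%N -> False.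
Proof.
move=> x1 y2 y3 ij pq qr; have pr := ltn_trans pq qr.
apply: (@not_face [:: xi k p; yi j q; yi i r]
  [:: (-1, [:: xi k p; yi j r; yi i q]);
      (-1, [:: xi k q; yi j p; yi i r]); (1, [:: xi k q; yi j r; yi i p]);
      (1, [:: xi k r; yi j p; yi i q]); (-1, [:: xi k r; yi j q; yi i p])]).
- eval_tangent.
- each_term; [apply: grevlex_mon_cons; last_cell (yi j r) | last_cell (xi k q) |
    last_cell (xi k q) | last_cell (xi k r) | last_cell (xi k r)].
- uniq_cells.
- sub_cells.
Qed.

(** Transposed situation: column r of A and columns q, p of B lie in the span of u and z. *)
Lemma face_D (i j k : 'I_m) (p q r : 'I_n) :
  xi i r \in F -> yi j q \in F -> yi k p \in F -> (i < j)%N -> (j < k)%N -> (p < q)%N -> False.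
Proof.
move=> x1 y2 y3 ij jk pq; have ik := ltn_trans ij jk.
apply: (@not_face [:: xi i r; yi j q; yi k p]
  [:: (-1, [:: xi i r; yi k q; yi j p]);
      (-1, [:: xi j r; yi i q; yi k p]); (1, [:: xi j r; yi i p; yi k q]);
      (1, [:: xi k r; yi i q; yi j p]); (-1, [:: xi k r; yi i p; yi j q])]).
- eval_tangent.
- each_term; [apply: grevlex_mon_cons; last_cell (yi k q) | last_cell (xi j r) |
    last_cell (xi j r) | last_cell (xi k r) | last_cell (xi k r)].
- uniq_cells.
- sub_cells.
Qed.

(** B = u w^T + z v^T has rank at most 2, so its 3-minors vanish. *)
Lemma face_E (i j k : 'I_m) (p q r : 'I_n) :
  yi i r \in F -> yi j q \in F -> yi k p \in F ->
  (i < j)%N -> (j < k)%N -> (p < q)%N -> (q < r)%N -> False.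
Proof.
move=> y1 y2 y3 ij jk pq qr; have ik := ltn_trans ij jk; have pr := ltn_trans pq qr.
apply: (@not_face [:: yi k p; yi j q; yi i r]
  [:: (-1, [:: yi k p; yi j r; yi i q]);
      (-1, [:: yi k q; yi j p; yi i r]); (1, [:: yi k q; yi j r; yi i p]);
      (1, [:: yi k r; yi j p; yi i q]); (-1, [:: yi k r; yi j q; yi i p])]).
- eval_tangent.
- each_term; [apply: grevlex_mon_cons; last_cell (yi j r) | last_cell (yi k q) |
    last_cell (yi k q) | last_cell (yi k r) | last_cell (yi k r)].
- uniq_cells.
- sub_cells.
Qed.

Lemma face_standard : exists py px, standard m n py px /\ F = cell_set m n py px.
Proof.
pose cells (c : 'I_m -> 'I_n -> 'I_N) i j :=
  [exists i' : 'I_m, [exists j' : 'I_n, [&& i' == i :> nat, j' == j :> nat & c i' j' \in F]]].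
have cellsP c i j : cells c i j ->
    exists (i' : 'I_m) (j' : 'I_n), [/\ i = i' :> nat, j = j' :> nat & c i' j' \in F].
  by case/existsP => i' /existsP[j' /and3P[/eqP<- /eqP<- h]]; exists i', j'.
exists (cells (@yi m n)), (cells (@xi m n)); split.
  split.
  - by move=> i j /cellsP[i' [j' [-> -> _]]]; rewrite !ltn_ord.
  - by move=> i j /cellsP[i' [j' [-> -> _]]]; rewrite !ltn_ord.
  - by move=> i j k l /cellsP[? [? [-> -> x1]]] /cellsP[? [? [-> -> x2]]]; exact: face_A x1 x2.
  - by move=> i j k l /cellsP[? [? [-> -> x1]]] /cellsP[? [? [-> -> x2]]]; exact: face_B x1 x2.
  - move=> i j k p q r /cellsP[? [? [_ -> x1]]] /cellsP[? [? [-> -> x2]]].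
    by move=> /cellsP[? [? [-> -> x3]]] ij _; exact: face_C x1 x2 x3 ij.
  - move=> i j k p q r /cellsP[? [? [-> _ x1]]] /cellsP[? [? [-> -> x2]]].
    by move=> /cellsP[? [? [-> -> x3]]] ij jk pq _; exact: face_D x1 x2 x3 ij jk pq.
  - move=> i j k p q r /cellsP[? [? [-> -> x1]]] /cellsP[? [? [-> -> x2]]].
    by move=> /cellsP[? [? [-> -> x3]]]; exact: face_E x1 x2 x3.
apply/setP => v; case: (cellP v) => [][i [j ->]]; rewrite ?mem_cell_y ?mem_cell_x.
  apply/idP/idP => [h|/cellsP[i' [j' [/val_inj-> /val_inj->]]] //].
  by apply/existsP; exists i; apply/existsP; exists j; rewrite !eqxx.
apply/idP/idP => [h|/cellsP[i' [j' [/val_inj-> /val_inj->]]] //].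
by apply/existsP; exists i; apply/existsP; exists j; rewrite !eqxx.
Qed.
End FaceStandard.

(** * Triples of paths are faces *)

Lemma later_yi m n (i i' : 'I_m) (j j' : 'I_n) : later i i' j j' -> (yi i j < yi i' j')%N.
Proof. by move=> /orP[/lt_yi_row->//|/andP[/eqP-> /lt_yi_col->]]. Qed.

Lemma later_xi m n (i i' : 'I_m) (j j' : 'I_n) : later i i' j j' -> (xi i j < xi i' j')%N.
Proof. by move=> /orP[/lt_xi_row->//|/andP[/eqP-> /lt_xi_col->]]. Qed.

Section Exponents.
Variables m n B : nat.

(* Kronecker substitution: [u_i], [v_j], [w_j] and [z_i] are replaced with powers
   of one variable whose exponents [wU], [wV], [wW] and [wZ] are distinct powers of
   [B], so that [weight] determines all margins smaller than [B]. *)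
Definition wU (i : 'I_m) : nat := (B ^ i)%N.
Definition wV (j : 'I_n) : nat := (B ^ m * B ^ j)%N.
Definition wW (j : 'I_n) : nat := (B ^ m * (B ^ n * B ^ j))%N.
Definition wZ (i : 'I_m) : nat := (B ^ m * (B ^ n * (B ^ n * B ^ i)))%N.

Definition weight (X Y1 Y2 : 'I_m -> 'I_n -> nat) : nat :=
  (\sum_(q : 'I_m * 'I_n) ((wU q.1 + wW q.2) * Y1 q.1 q.2 + (wZ q.1 + wV q.2) * Y2 q.1 q.2) +
   \sum_(q : 'I_m * 'I_n) (wU q.1 + wV q.2) * X q.1 q.2)%N.

(** The blocks of digits in base [B] are the margins of u, v, w and z; the final 0 is the last
    remainder for [digits_inj]. *)
Lemma weightE X Y1 Y2 : weight X Y1 Y2 =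
  (\sum_i (\sum_j X i j + \sum_j Y1 i j) * B ^ i +
   B ^ m * (\sum_j (\sum_i X i j + \sum_i Y2 i j) * B ^ j +
   B ^ n * (\sum_j (\sum_i Y1 i j) * B ^ j +
   B ^ n * (\sum_i (\sum_j Y2 i j) * B ^ i + B ^ m * 0))))%N.
Proof.
rewrite muln0 addn0.
have rowE (w : 'I_m -> nat) (Z : 'I_m -> 'I_n -> nat) :
    (\sum_(q : 'I_m * 'I_n) w q.1 * Z q.1 q.2 = \sum_i (\sum_j Z i j) * w i)%N.
  rewrite -(pair_bigA _ (fun i j => w i * Z i j)%N) /=.
  by apply: eq_bigr => i _; rewrite mulnC big_distrr.
have colE (w : 'I_n -> nat) (Z : 'I_m -> 'I_n -> nat) :
    (\sum_(q : 'I_m * 'I_n) w q.2 * Z q.1 q.2 = \sum_j (\sum_i Z i j) * w j)%N.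
  rewrite -(pair_bigA _ (fun i j => w j * Z i j)%N) exchange_big /=.
  by apply: eq_bigr => j _; rewrite mulnC big_distrr.
have scale k (I : finType) (f g : I -> nat) :
    (\sum_i f i * (k * g i) = k * \sum_i f i * g i)%N.
  by rewrite big_distrr; apply: eq_bigr => i _; rewrite /= mulnCA.
rewrite /weight (eq_bigr (fun q => wU q.1 * Y1 q.1 q.2 + wW q.2 * Y1 q.1 q.2 +
  (wZ q.1 * Y2 q.1 q.2 + wV q.2 * Y2 q.1 q.2))%N) => [|q _]; last by rewrite !mulnDl.
rewrite [X in (_ + X)%N](eq_bigr (fun q => wU q.1 * X q.1 q.2 + wV q.2 * X q.1 q.2)%N)
  => [|q _]; last by rewrite mulnDl.
rewrite !big_split /= !rowE !colE /wU /wV /wW /wZ !scale.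
under [in RHS]eq_bigr do rewrite mulnDl.
under [X in (_ = _ + _ * (X + _))%N]eq_bigr do rewrite mulnDl.
rewrite !big_split /= !mulnDr; lia.
Qed.

Lemma weight_inj X Y1 Y2 X' Y1' Y2' :
  (forall i, \sum_j X i j + \sum_j Y1 i j < B)%N ->
  (forall i, \sum_j X' i j + \sum_j Y1' i j < B)%N ->
  (forall j, \sum_i X i j + \sum_i Y2 i j < B)%N ->
  (forall j, \sum_i X' i j + \sum_i Y2' i j < B)%N ->
  (forall j, \sum_i Y1 i j < B)%N -> (forall j, \sum_i Y1' i j < B)%N ->
  (forall i, \sum_j Y2 i j < B)%N -> (forall i, \sum_j Y2' i j < B)%N ->
  weight X Y1 Y2 = weight X' Y1' Y2' ->
  [/\ forall i, (\sum_j X i j + \sum_j Y1 i j = \sum_j X' i j + \sum_j Y1' i j)%N,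
      forall j, (\sum_i X i j + \sum_i Y2 i j = \sum_i X' i j + \sum_i Y2' i j)%N,
      forall j, (\sum_i Y1 i j = \sum_i Y1' i j)%N &
      forall i, (\sum_j Y2 i j = \sum_j Y2' i j)%N].
Proof.
move=> b1 b1' b2 b2' b3 b3' b4 b4'; rewrite !weightE.
move=> /(digits_inj b1 b1')[e1] /(digits_inj b2 b2')[e2] /(digits_inj b3 b3')[e3].
by move=> /(digits_inj b4 b4')[e4 _].
Qed.
End Exponents.

Section PathFace.
Variables (K : closedFieldType) (m n : nat) (d : path_data).
Hypothesis vd : valid m n d.
Local Notation N := (m * n + m * n)%N.

Variables (p : {mpoly K[N]}) (a : 'X_{1..N}).
Hypothesis lead_a : leading_monomial p a.
Hypothesis supp_a : forall v, a v != 0%N -> v \in path_set m n d.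

(** [D] bounds all exponents in [p], and a margin is a sum of at most 2 (m + n) numbers bounded by
    [D], so it is less than [B]. *)
Let D := msize p.
Let B := (2 * (m + n) * D).+1.
Let wU := @wU m B. Let wV := @wV m n B. Let wW := @wW m n B. Let wZ := @wZ m n B.

Let split_type := {ffun 'I_m * 'I_n -> 'I_D.+1}.
(* [c q] is the number of factors [y_q] of a monomial [b] for which [z_i v_j] is
   chosen, so that [Y1 b c] and [Y2 c] count the choices of [u_i w_j] and [z_i v_j]. *)
Let X (b : 'X_{1..N}) i j := b (xi i j).
Let Y1 (b : 'X_{1..N}) (c : split_type) i j := (b (yi i j) - c (i, j))%N.
Let Y2 (c : split_type) (i : 'I_m) (j : 'I_n) := nat_of_ord (c (i, j)).
Let c0 : split_type :=
  [ffun q : 'I_m * 'I_n => if lower m d q.1 q.2 then inord (a (yi q.1 q.2)) else ord0].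

Lemma supp_bound b v : b \in msupp p -> (b v <= D)%N.
Proof.
move=> /msize_mdeg_lt; rewrite mdegE => lt.
by apply: leq_trans (ltnW lt); rewrite (bigD1 v) //= leq_addr.
Qed.

Lemma a_supp : a \in msupp p. Proof. by case: lead_a. Qed.

Lemma Y2_c0 i j : Y2 c0 i j = if lower m d i j then a (yi i j) else 0%N.
Proof.
by rewrite /Y2 ffunE /=; case: ifP => // _; rewrite inordK // ltnS; apply: supp_bound a_supp.
Qed.

Lemma Y1_c0 i j : Y1 a c0 i j = if lower m d i j then 0%N else a (yi i j).
Proof. by rewrite /Y1 -/(Y2 c0 i j) Y2_c0; case: ifP; rewrite ?subnn ?subn0. Qed.

Lemma bound2 (k : nat) (f g : 'I_k -> nat) : (k <= m + n)%N ->
  (forall i, f i <= D)%N -> (forall i, g i <= D)%N -> (\sum_i f i + \sum_i g i < B)%N.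
Proof.
move=> km fD gD; have sf : (\sum_i f i <= k * D)%N.
  by rewrite -[k in X in (_ <= X)%N]card_ord -sum_nat_const; apply: leq_sum.
have sg : (\sum_i g i <= k * D)%N.
  by rewrite -[k in X in (_ <= X)%N]card_ord -sum_nat_const; apply: leq_sum.
have : (k * D <= (m + n) * D)%N by rewrite leq_mul2r km orbT.
by rewrite ltnS -mulnA; lia.
Qed.

(** Equal weights give equal margins, so the transport lemmas apply: they contradict b < a, and for
    b = a they force the choice [c0]. *)
Lemma split_unique b (c : split_type) : b \in msupp p -> (forall i j, c (i, j) <= b (yi i j))%N ->
  weight B (X b) (Y1 b c) (Y2 c) = weight B (X a) (Y1 a c0) (Y2 c0) -> b = a /\ c = c0.
Proof.
move=> bp cb E.
have b1 (f g : 'I_m -> nat) := @bound2 m f g (leq_addr _ _).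
have b2 (f g : 'I_n -> nat) := @bound2 n f g (leq_addl _ _).
have bX b' i j : b' \in msupp p -> (X b' i j <= D)%N by exact: supp_bound.
have bY1 b' c' i j : b' \in msupp p -> (Y1 b' c' i j <= D)%N.
  by move=> b'p; apply: leq_trans (leq_subr _ _) (supp_bound _ b'p).
have bY2 c' i j : (Y2 c' i j <= D)%N by rewrite -ltnS; apply: ltn_ord.
have ap := a_supp.
have weak k l : (k + l < B -> l < B)%N by lia.
have [||||||||mU mV mW mZ] := weight_inj _ _ _ _ _ _ _ _ E.
- by move=> i; apply: b2 => j; [apply: bX | apply: bY1].
- by move=> i; apply: b2 => j; [apply: bX | apply: bY1].
- by move=> j; apply: b1 => i; [apply: bX | apply: bY2].
- by move=> j; apply: b1 => i; [apply: bX | apply: bY2].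
- by move=> j; apply: (weak _ _ (b1 (fun i => X b i j) _ _ _)) => i; [apply: bX | apply: bY1].
- by move=> j; apply: (weak _ _ (b1 (fun i => X b i j) _ _ _)) => i; [apply: bX | apply: bY1].
- by move=> i; apply: (weak _ _ (b2 (fun j => X b i j) _ _ _)) => j; [apply: bX | apply: bY2].
- by move=> i; apply: (weak _ _ (b2 (fun j => X b i j) _ _ _)) => j; [apply: bX | apply: bY2].
have sX i j : X a i j != 0%N -> xcells m d i j.
  by move=> /supp_a; rewrite mem_cell_x.
have s1 i j : Y1 a c0 i j != 0%N -> upper d i j.
  rewrite Y1_c0; case: ifP => // nl /supp_a; rewrite mem_cell_y /ycells nl orbF.
  by [].
have s2 i j : Y2 c0 i j != 0%N -> lower m d i j by rewrite Y2_c0; case: ifP.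
have tX := transportX vd sX s1 s2 mU mV mW.
have t1 := transport1 vd s1 mU mW.
have t2 := transport2 vd s2 mV mZ.
have tl := transport_later vd s1 s2 mU mV mW mZ.
have sumY i j : (Y1 b c i j + Y2 c i j = b (yi i j))%N by rewrite subnK.
have sumY0 i j : (Y1 a c0 i j + Y2 c0 i j = a (yi i j))%N.
  by rewrite Y1_c0 Y2_c0; case: ifP => _; rewrite ?addn0.
have leY (eX : forall i j, X b i j = X a i j) i j :
    (forall i' j', later i i' j j' -> b (yi i' j') = a (yi i' j')) ->
    (Y1 b c i j <= Y1 a c0 i j)%N /\ (Y2 c i j <= Y2 c0 i j)%N.
  move=> lt; have lat := tl eX i j (fun i' j' h => etrans (sumY i' j')
    (etrans (lt i' j' h) (esym (sumY0 i' j')))).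
  split; [apply: (t1 eX) | apply: (t2 eX)] => i' j' h; by have [] := lat i' j' h.
have Ea : b = a.
  have [_ /(_ b bp)[//|[ltd|[_ [v [ltv eqv]]]]]] := lead_a.
    (* A smaller degree is impossible, since the margins determine the degree. *)
    have mdegN (b' : 'X_{1..N}) :
        mdeg b' = (\sum_i \sum_j b' (yi i j) + \sum_i \sum_j b' (xi i j))%N.
      by rewrite mdegE big_split_ord /= !big_mxvec_index.
    have tot b' c' : (forall i j, Y1 b' c' i j + Y2 c' i j = b' (yi i j))%N -> mdeg b' =
       (\sum_i \sum_j Y1 b' c' i j + \sum_i \sum_j Y2 c' i j + \sum_i \sum_j X b' i j)%N.
      move=> sY; rewrite mdegN; congr (_ + _)%N; rewrite -big_split; apply: eq_bigr => i _ /=.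
      by rewrite -big_split; apply: eq_bigr => j _ /=.
    move: ltd; rewrite (tot _ _ sumY) (tot _ _ sumY0).
    by rewrite (totalX mU mW) (total1 mW) (total2 mZ) ltnn.
  (* At the last variable where they differ, b has the larger exponent, against the transport bound.
     If this is a y-cell, all x-exponents agree because the x-cells are numbered last. *)
  case: (cellP v) ltv eqv => [][i [j ->]] ltv eqv; last first.
    by have := tX i j (fun i' j' h => eqv _ (later_xi h)); rewrite /X leqNgt ltv.
  have eX i' j' : X b i' j' = X a i' j' by apply: eqv; apply: lt_yi_xi.
  have [le1 le2] := leY eX i j (fun i' j' h => eqv _ (later_yi h)).
  by move: ltv; rewrite -sumY -sumY0; lia.
split=> //; apply/ffunP => -[i j]; apply/val_inj => /=.
have [le1 le2] := leY (fun i' j' => congr1 (X^~ i' ^~ j') Ea) i j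
  (fun i' j' h => congr1 (fun a' : 'X_{1..N} => a' (yi i' j')) Ea).
have Eab : b (yi i j) = a (yi i j) by rewrite Ea.
move: le1 le2 (sumY i j) (sumY0 i j); rewrite Eab.
by set y1 := Y1 b c i j; set y10 := Y1 a c0 i j; rewrite /Y2; lia.
Qed.

(** The parametrization along the curve where u, v, w, z are powers of one variable; [P] below is
    [p] restricted to this curve. *)
Let phi : 'rV[{poly K}]_N :=
  row_mx (mxvec (\matrix_(i < m, j < n) ('X^(wU i + wW j) + 'X^(wZ i + wV j))))
         (mxvec (\matrix_(i < m, j < n) 'X^(wU i + wV j))).

Let P : {poly K} := \sum_(b <- msupp p) p@_b *: \prod_v phi 0 v ^+ b v.

Lemma phi_y i j : phi 0 (yi i j) = 'X^(wU i + wW j) + 'X^(wZ i + wV j).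
Proof. by rewrite /phi /yi row_mxEl mxvecE mxE. Qed.

Lemma phi_x i j : phi 0 (xi i j) = 'X^(wU i + wV j).
Proof. by rewrite /phi /xi row_mxEr mxvecE mxE. Qed.

Lemma horner_curve t : P.[t] = p.@[tangent_point (fun i => t ^+ wU i) (fun i => t ^+ wZ i)
   (fun j => t ^+ wV j) (fun j => t ^+ wW j) 0].
Proof.
rewrite mevalE horner_sum; apply: eq_bigr => b _; rewrite hornerZ horner_prod; congr (_ * _).
apply: eq_bigr => v _; rewrite horner_exp; congr (_ ^+ _).
case: (cellP v) => [][i [j ->]].
  by rewrite phi_y tangent_point_y hornerD !hornerXn !exprD.
by rewrite phi_x tangent_point_x hornerXn exprD.
Qed.

Lemma curve_monomial b : b \in msupp p -> \prod_v phi 0 v ^+ b v =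
  \sum_(c : split_type) (\prod_q 'C(b (yi q.1 q.2), c q))%N%:R *:
    'X^(weight B (X b) (Y1 b c) (Y2 c)).
Proof.
move=> bp; rewrite big_split_ord /= !big_mxvec_index.
rewrite (eq_bigr (fun i => \prod_j ('X^(wU i + wW j) + 'X^(wZ i + wV j)) ^+ b (yi i j)));
  last by move=> i _; apply: eq_bigr => j _; rewrite -phi_y.
rewrite [X in _ * X](eq_bigr (fun i => \prod_j 'X^(wU i + wV j) ^+ b (xi i j)));
  last by move=> i _; apply: eq_bigr => j _; rewrite -phi_x.
rewrite !pair_bigA /= (@prod_binom_exp _ _ (fun q => wU q.1 + wW q.2)%N
  (fun q => wZ q.1 + wV q.2)%N (fun q => b (yi q.1 q.2)) D); last by move=> q; apply: supp_bound.
rewrite mulr_suml; apply: eq_bigr => c _; rewrite -scalerAl; congr (_ *: _).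
rewrite (eq_bigr (fun q => 'X^((wU q.1 + wV q.2) * b (xi q.1 q.2)))) => [|q _];
  last by rewrite exprM.
rewrite -(big_morph _ (exprD 'X) (expr0 'X)) -exprD; congr ('X^(_ + _)).
by apply: eq_bigr => -[i j] _.
Qed.

(** By [split_unique] only the monomial a with the choice [c0] contributes. Its binomial
    coefficients are all 1, since [c0] chooses all or none of the factors of each y-cell. *)
Lemma curve_coef : P`_(weight B (X a) (Y1 a c0) (Y2 c0)) = p@_a.
Proof.
rewrite coef_sum (bigD1_seq a) ?a_supp ?msupp_uniq //= coefZ curve_monomial ?a_supp //.
rewrite [X in _ + X]big_seq_cond [X in _ + X]big1 ?addr0; last first.
  move=> b /andP[bp ba]; rewrite coefZ curve_monomial // coef_sum big1 ?mulr0 // => c _.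
  rewrite coefZ coefXn; case: eqP => [E|]; last by rewrite mulr0.
  have [/forallP cb|/forallPn[[i j] /= ncb]] := boolP [forall q, c q <= b (yi q.1 q.2)]%N.
    by case: (split_unique bp (fun i j => cb (i, j)) (esym E)) => Eb; rewrite Eb eqxx in ba.
  by rewrite (bigD1 (i, j)) //= bin_small ?mul0n ?mul0r // ltnNge.
rewrite coef_sum (bigD1 c0) //= coefZ coefXn eqxx mulr1 [X in _ + X]big1; last first.
  move=> c nc; rewrite coefZ coefXn; case: eqP => [E|]; last by rewrite mulr0.
  have [/forallP cb|/forallPn[[i j] /= ncb]] := boolP [forall q, c q <= a (yi q.1 q.2)]%N.
    by case: (split_unique a_supp (fun i j => cb (i, j)) (esym E)) => _ Ec; rewrite Ec eqxx in nc.
  by rewrite (bigD1 (i, j)) //= bin_small ?mul0n ?mul0r // ltnNge.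
rewrite big1 ?addr0 ?mulr1 // => -[i j] _ /=.
have := Y2_c0 i j; rewrite /Y2 => ->.
by case: ifP; rewrite ?binn ?bin0.
Qed.

(** For nonzero t the curve lies in the principal component, so [P] would vanish there and be 0,
    against [curve_coef]. *)
Lemma path_not_leading : ~ principal_ideal p.
Proof.
move=> Jp; have m0 : (0 < m)%N by have := lt_pa vd; lia.
have n0 : (0 < n)%N by have := lt_pb vd; lia.
have P0 : P = 0.
  apply: closed_field_poly_eq0 => t t0; rewrite horner_curve; apply: Jp.
  by apply: (@tangent_point_component _ _ _ _ _ _ _ (Ordinal m0) (Ordinal n0)); rewrite expf_neq0.
have := a_supp; rewrite mcoeff_msupp -curve_coef P0 coef0.
by rewrite eqxx.
Qed.
End PathFace.

Lemma ideal_gen_coef (K : fieldType) N (S : {mpoly K[N]} -> Prop) (q : {mpoly K[N]}) a :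
  ideal_gen S q -> q@_a != 0 -> exists c, S c.2 /\ (c.1 * c.2)@_a != 0.
Proof.
move=> [s [sS ->]] nz; apply: NNPP => ne; move: nz; rewrite raddf_sum /=.
rewrite big_seq big1 ?eqxx // => c /sS Sc.
by apply/eqP/negPn/negP => nz; apply: ne; exists c.
Qed.

Lemma path_set_face (K : closedFieldType) m n d : valid m n d ->
  jet_complex K m n (path_set m n d).
Proof.
move=> vd; set F := path_set m n d.
pose mF : 'X_{1..(m * n + m * n)} := [multinom (v \in F : nat) | v < _].
have prodF : \prod_(v in F) 'X_v = 'X_[mF] :> {mpoly K[_]}.
  rewrite mpolyXE_id big_mkcond; apply: eq_bigr => v _; rewrite mnmE.
  by case: (v \in F); rewrite ?expr1 ?expr0.
have mF1 : (\prod_(v in F) 'X_v : {mpoly K[_]})@_mF != 0.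
  by rewrite prodF mcoeffX eqxx oner_neq0.
(* The face condition takes the ideal generated by the leading ideal, so two layers of generation
   are unfolded to find a leading monomial dividing that of [F]. *)
move=> /ideal_gen_coef/(_ mF1)[c [/(@ideal_gen_mull _ _ _ _ c.1) LTc]].
move=> /(ideal_gen_coef LTc)[e [[p [Jp [a [la ->]]]]]].
rewrite -scalerAr -mcoeff_msupp => /msuppZ_le.
rewrite (perm_mem (msuppMX _ _)) => /mapP[b _ Eb].
apply: (path_not_leading vd la _ Jp) => v av.
have := congr1 (fun b' : 'X_{1.._} => b' v) Eb; rewrite /= mnmE mnmDE -/F.
by case: (v \in F) => //= Ea; case/eqP: av; lia.
Qed.

Local Close Scope ring_scope.

(** * Facets *)

Section Facets.
Variables (K : closedFieldType) (m n : nat).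
Hypothesis m1 : 1 < m.
Hypothesis n1 : 1 < n.

Lemma face_sub_path_set F : jet_complex K m n F ->
  exists d, valid m n d /\ F \subset path_set m n d.
Proof.
move=> faceF; pose std S := exists py px, standard m n py px /\ S = cell_set m n py px.
(* A largest standard set containing [F] is found as one with the smallest complement. *)
have [|k [[S [[py [px [st SE]]] [FS Sk]]] mink]] :=
    @ex_minimal (fun k => exists S, std S /\ (F \subset S /\ #|~: S| = k)).
  by exists #|~: F|, F; split; first exact: face_standard faceF.
have max_set S' : std S' -> S \subset S' -> S' = S.
  move=> stS' SS'; apply/esym/eqP; rewrite eqEcard SS' /=.
  rewrite -(leq_add2r #|~: S'|) cardsC -(cardsC S) leq_add2l Sk.
  by apply: mink; exists S'; split=> //; split=> //; apply: subset_trans SS'.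
have max_y i0 j0 : i0 < m -> j0 < n -> standard m n (add_cell py i0 j0) px -> py i0 j0.
  move=> im jn st'; have : cell_set m n (add_cell py i0 j0) px = S.
    apply: max_set; first by exists (add_cell py i0 j0), px.
    rewrite SE; apply/subsetP => v.
    case: (cellP v) => [][i [j ->]]; rewrite ?mem_cell_y ?mem_cell_x //.
    by rewrite /add_cell => ->.
  move/setP/(_ (yi (Ordinal im) (Ordinal jn))); rewrite SE !mem_cell_y /= => <-.
  by rewrite /add_cell !eqxx orbT.
have max_x i0 j0 : i0 < m -> j0 < n -> standard m n py (add_cell px i0 j0) -> px i0 j0.
  move=> im jn st'; have : cell_set m n py (add_cell px i0 j0) = S.
    apply: max_set; first by exists py, (add_cell px i0 j0).
    rewrite SE; apply/subsetP => v.
    case: (cellP v) => [][i [j ->]]; rewrite ?mem_cell_y ?mem_cell_x //.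
    by rewrite /add_cell => ->.
  move/setP/(_ (xi (Ordinal im) (Ordinal jn))); rewrite SE !mem_cell_x /= => <-.
  by rewrite /add_cell !eqxx orbT.
have [a [b [xab ab_ne min_ab]]] := max_x_min m1 n1 st max_x.
have [d [vd sy sx]] := maximal_standard_path m1 n1 st max_y max_x xab ab_ne min_ab.
exists d; split=> //; apply: subset_trans FS _; rewrite SE.
by apply/subsetP => v; case: (cellP v) => [][i [j ->]]; rewrite ?mem_cell_y ?mem_cell_x; auto.
Qed.

(** Every face lies in a path set, path sets are faces, and their equal cardinality excludes proper
    inclusions among them. *)
Lemma jet_facetE F : facet (jet_complex K m n) F <-> exists d, valid m n d /\ path_set m n d = F.
Proof.
split=> [[faceF maxF]|[d [vd <-]]].
  have [d [vd Fd]] := face_sub_path_set faceF.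
  by exists d; split=> //; apply: maxF Fd; apply: path_set_face.
split=> [|G faceG dG]; first exact: path_set_face.
have [d' [vd' Gd']] := face_sub_path_set faceG.
apply/eqP; rewrite eqEsubset dG andbT.
suff -> : path_set m n d = path_set m n d' by [].
apply/eqP; rewrite eqEcard (subset_trans dG Gd') /=.
by rewrite -(leq_add2r 2) !card_path_set.
Qed.

Lemma jet_pure : pure (jet_complex K m n).
Proof.
move=> F G /jet_facetE[d [vd <-]] /jet_facetE[d' [vd' <-]].
by apply: (@addIn 2); rewrite !card_path_set.
Qed.
End Facets.

Theorem theorem3p2 (K : closedFieldType) (m n : nat) (le2m : (2 <= m)%N)
    (lemn : (m <= n)%N) :
  shellable (jet_complex K m n).
Proof.
have n1 := leq_trans le2m lemn.
apply: (@shellable_by_key _ _ _ (valid m n) (path_set m n) (key m n)).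
- exact: jet_facetE.
- exact: jet_pure.
by move=> c d vc vd; apply: exchange.
Qed.
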